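(* Let $R\in\mathbb{C}(z)\setminus\mathbb{C}$ be a non-constant rational map, and let $\eta\in\mathbb{C}$ with $|\eta|=1$. Suppose that there exists a complex number $\gamma\in\mathbb{C}$ such that the set $$\left\{n\in\mathbb{Z} : R(\eta^n)\in\gamma\cdot\mathbb{Z}\right\}$$ is infinite. Then $\eta$ is a root of unity.
   Context: Here $\gamma\cdot\mathbb{Z}=\{\gamma k : k\in\mathbb{Z}\}\subseteq\mathbb{C}$, and $R$ is viewed as a map $\mathbb{P}^1(\mathbb{C})\to\mathbb{P}^1(\mathbb{C})$; in particular, if $\eta^n$ is a pole of $R$ then $R(\eta^n)=\infty\notin\gamma\cdot\mathbb{Z}$. *)

(* Defs.v *)
From HB Require Import structures.
From mathcomp Require Import all_boot all_order all_algebra.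
From mathcomp Require Import complex.
From mathcomp Require Import boolp classical_sets cardinality reals.

Set Implicit Arguments.
Unset Strict Implicit.
Unset Printing Implicit Defensive.

Import GRing.Theory.
Local Open Scope ring_scope.
Local Open Scope quotient_scope.

Local Notation "x %:F" := (@FracField.tofrac _ x).

Lemma fracE (R : idomainType) (f : {fraction R}) :
  f = (\n_(repr f))%:F / (\d_(repr f))%:F.
Proof.
set r := repr f.
have d0 : \d_r != 0 by exact: denom_ratioP.
have dF : (\d_r)%:F != 0 by rewrite tofrac_eq0.
apply: (canRL (mulfK dF)).
rewrite -[f]reprK -/r.
rewrite -[LHS]/(FracField.mul (\pi r) (\d_r)%:F).
rewrite !piE.
apply/eqmodP => /=.
rewrite FracField.equivfE /FracField.mulf !numden_Ratio ?mulf_neq0 ?oner_neq0 //.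
by rewrite !mulr1 mulrC.
Qed.

Section RationalMap.
Variable F : fieldType.
Implicit Types (f : {fraction {poly F}}) (p q : {poly F}).

(* The projective line over F is [option F], with [None] the point at infinity;
   [proj_point a b] is the point with homogeneous coordinates [a : b]. *)
Definition proj_point (a b : F) : option F :=
  if b == 0 then None else Some (a / b).

(* [repr f] is an arbitrary representative, so common factors are removed
   before evaluating. *)
Definition ratnum f : {poly F} :=
  \n_(repr f) %/ gcdp \n_(repr f) \d_(repr f).
Definition ratden f : {poly F} :=
  \d_(repr f) %/ gcdp \n_(repr f) \d_(repr f).

(* At infinity, the coefficients of degree [maxn (deg p) (deg q)] are the values
   at [1 : 0] of the homogenizations of the numerator p and denominator q. *)
Definition ratmap f (x : option F) : option F :=
  let p := ratnum f in
  let q := ratden f in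
  match x with
  | Some z => proj_point p.[z] q.[z]
  | None => let d := (maxn (size p) (size q)).-1 in proj_point p`_d q`_d
  end.

Definition nonconstant f : Prop := forall c : F, f <> (c%:P)%:F.

Lemma ratmap_frac p q (z : F) : q != 0 -> coprimep p q ->
  ratmap (p%:F / q%:F) (Some z) = proj_point p.[z] q.[z].
Proof.
move=> q0 cpq; rewrite /ratmap /ratnum /ratden.
have := fracE (p%:F / q%:F); set r := repr _ => fE.
have d0 : \d_r != 0 by exact: denom_ratioP.
have pdE : p * \d_r = \n_r * q.
  apply/eqP; rewrite -tofrac_eq !tofracM.
  by rewrite -eqr_div ?tofrac_eq0 //; apply/eqP.
move: (frac r).1 (frac r).2 d0 pdE => n d d0 pdE.
set g := gcdp n d; set a := n %/ g; set b := d %/ g.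
have g0 : g != 0 by rewrite gcdp_eq0 negb_and d0 orbT.
have aE : n = a * g by rewrite divpK ?dvdp_gcdl.
have bE : d = b * g by rewrite divpK ?dvdp_gcdr.
have cab : coprimep a b by apply: coprimep_div_gcd; rewrite d0 orbT.
have b0 : b != 0 by apply: contraNneq d0 => b0; rewrite bE b0 mul0r.
have pbE : p * b = a * q.
  by apply: (mulIf g0); rewrite -mulrA -bE pdE aE mulrAC.
have /eqpP[[c1 c2] /= /andP[c10 c20] qbE] : q %= b.
  rewrite /eqp -(@Gauss_dvdpr _ b p q) 1?coprimep_sym // pbE dvdp_mull //=.
  by rewrite -(@Gauss_dvdpr _ q a b) 1?coprimep_sym // -pbE dvdp_mull.
have qE : q = (c2 / c1) *: b.
  by rewrite mulrC -scalerA -qbE scalerA mulVf // scale1r.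
have c0 : c2 / c1 != 0 by rewrite mulf_neq0 ?invr_eq0.
have pE : p = (c2 / c1) *: a.
  by apply: (mulIf b0); rewrite pbE qE -scalerAr scalerAl.
rewrite pE qE !hornerZ /proj_point mulf_eq0 (negPf c0) /=.
by case: eqP => // /eqP bz0; rewrite -mulf_div divff // mul1r.
Qed.

End RationalMap.

(* Main.v *)
(* Suppose that eta is not a root of unity. Solving the linear system
   P(eta^n) = k_n Q(eta^n) shows that P and Q may be taken with coefficients
   p, q in Z[eta]. If eta is transcendental, p(t, t^n) = k_n q(t, t^n) holds in
   Z[t], and for large n comparing coefficients makes k_n constant.

   Otherwise let f be the primitive minimal polynomial of eta over Z, with
   leading coefficient a and roots rho, and put
     N_n := a^(e + d n) \prod_rho q(rho, rho^n), an integer.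
   Since q(eta, eta^n) divides p(eta, eta^n), eliminating with the resultant of p
   and q and taking contents shows that N_n divides a fixed integer. So N_n takes
   some value c infinitely often, and by Skolem-Mahler-Lech N_n = c along an
   arithmetic progression. This contradicts the exponential growth of N_n,
   which comes from the Mahler measure of f being > 1 (Kronecker); it requires q not to
   be a monomial, but otherwise P/Q is bounded on the unit circle, the k_n are
   bounded and one of them is attained infinitely often. *)
From HB Require Import structures.
Require Import Defs.
From mathcomp Require Import all_boot all_order fingroup cyclic all_algebra.
From mathcomp Require Import separable complex zify ring lra.
From mathcomp Require Import boolp classical_sets cardinality reals.

Set Implicit Arguments.
Unset Strict Implicit.
Unset Printing Implicit Defensive.

Import Order.TTheory GRing.Theory Num.Theory.
Local Open Scope classical_set_scope.
Local Open Scope ring_scope.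

(** Two obstacles shape the proof. First, eta need not be an algebraic integer, so taking norms in a
    divisibility of Z[eta] costs powers of a that grow with n, and a bound N_n | M a^(O(n)) would be
    useless. The elimination therefore exhibits Res(t) t^l as a multiple of q(t, t^n) at t = eta for
    every l up to L = 2dn - 1. These relations combine into one with right-hand side Res(t) (T -
    t)^L, whose norm contains f(T)^L: L powers of a disappear into this primitive polynomial, and
    the number left over is bounded. Second, for rho on the unit circle, rho^n may come very close
    to a zero of q(rho, .), so N_n has no elementary lower bound valid for all n. Skolem-Mahler-Lech
    gives the freedom to avoid this: N_n is constant on a whole progression n_0 + N m, and by
    simultaneous recurrence m can be chosen so that every rho^n on the circle is close to rho^(n_0),
    where q(rho, .) does not vanish. *)

(** * Pigeonhole for sets of naturals that are unbounded *)

Lemma frequently_pigeonhole (I : finType) (S : nat -> Prop) (c : nat -> I) :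
  (forall N, exists2 n, (N <= n)%N & S n) ->
  exists i, forall N, exists2 n, (N <= n)%N & S n /\ c n = i.
Proof.
move=> freqS; apply: contrapT => /forallNP nfreq.
have bound i : exists N, forall n, (N <= n)%N -> S n -> c n <> i.
  move: (nfreq i) => /existsNP[N nN]; exists N => n Nn Sn cn.
  by apply: nN; exists n.
have [B BP] := choice bound.
have [n Bn Sn] := freqS (\max_i B i).
by apply: (BP (c n) n) => //; apply: leq_trans Bn; exact: leq_bigmax.
Qed.

Lemma frequently_bounded (S : nat -> Prop) (h : nat -> int) B :
  (forall N, exists2 n, (N <= n)%N & S n /\ (`|h n| <= B)%N) ->
  exists c, forall N, exists2 n, (N <= n)%N & S n /\ h n = c.
Proof.
move=> /(frequently_pigeonhole (fun n => inord `|(h n + B%:Z)%R|%N : 'I_(B + B).+1)).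
move=> [i iP]; exists (i%:Z - B%:Z) => N; have [n Nn [[Sn hB] hi]] := iP N.
exists n => //; split=> //; move: hi => /(congr1 val); rewrite /= inordK; lia.
Qed.

Lemma frequently_seq (S : nat -> Prop) l : (forall N, exists2 n, (N <= n)%N & S n) ->
  exists ms : seq nat, [/\ uniq ms, size ms = l & forall x, x \in ms -> S x].
Proof.
move=> freqS; elim: l => [|l [ms [ums sms hms]]]; first by exists [::].
have [x xm hx] := freqS (\max_(y <- ms) y).+1.
exists (x :: ms); split=> /=; last 1 first.
- by move=> y; rewrite in_cons => /orP[/eqP->|/hms].
- rewrite ums andbT; apply/negP => xms.
  by move: xm; rewrite ltnNge => /negP; apply; exact: leq_bigmax_seq.
- by rewrite sms.
Qed.

(** * Zeros of p-adically analytic integer sequences *)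

Section PadicPolynomial.
Variable p : nat.

(** Stands for a p-adic power series in p m: modulo each p^K such a series is an integer polynomial,
    and these truncations replace the p-adic completion. *)
Definition padic_poly (h : nat -> int) :=
  forall K, exists F : {poly int}, forall m,
    (p%:Z ^+ K %| h m - F.[p%:Z * m%:Z])%Z.

Lemma padic_poly_ext g h : g =1 h -> padic_poly g -> padic_poly h.
Proof. by move=> gh hg K; have [F FP] := hg K; exists F => m; rewrite -gh. Qed.

Lemma padic_poly_const c : padic_poly (fun=> c).
Proof. by move=> K; exists c%:P => m; rewrite hornerC subrr dvdz0. Qed.

Lemma padic_polyD g h :
  padic_poly g -> padic_poly h -> padic_poly (fun m => g m + h m).
Proof.
move=> hg hh K; have [F FP] := hg K; have [G GP] := hh K.
by exists (F + G) => m; rewrite hornerD opprD addrACA; exact: rpredD.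
Qed.

Lemma padic_polyM g h :
  padic_poly g -> padic_poly h -> padic_poly (fun m => g m * h m).
Proof.
move=> hg hh K; have [F FP] := hg K; have [G GP] := hh K.
exists (F * G) => m; rewrite hornerM.
have -> : g m * h m - F.[p%:Z * m%:Z] * G.[p%:Z * m%:Z] =
  (g m - F.[p%:Z * m%:Z]) * h m + F.[p%:Z * m%:Z] * (h m - G.[p%:Z * m%:Z]).
  by ring.
by apply: rpredD; [exact: dvdz_mulr | exact: dvdz_mull].
Qed.

Lemma padic_polyB g h :
  padic_poly g -> padic_poly h -> padic_poly (fun m => g m - h m).
Proof.
move=> hg hh; have := padic_polyD hg (padic_polyM (padic_poly_const (-1)) hh).
by apply: padic_poly_ext => m; rewrite mulN1r.
Qed.

Lemma padic_poly_sum (I : Type) (r : seq I) (P : pred I) (h : I -> nat -> int) :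
  (forall i, padic_poly (h i)) -> padic_poly (fun m => \sum_(i <- r | P i) h i m).
Proof.
move=> hh; elim: r => [|i r IH].
  by apply: padic_poly_ext (padic_poly_const 0) => m; rewrite big_nil.
case Pi: (P i); last by apply: padic_poly_ext IH => m; rewrite big_cons Pi.
by apply: padic_poly_ext (padic_polyD (hh i) IH) => m; rewrite big_cons Pi.
Qed.

Lemma padic_poly_prod (I : Type) (r : seq I) (P : pred I) (h : I -> nat -> int) :
  (forall i, padic_poly (h i)) -> padic_poly (fun m => \prod_(i <- r | P i) h i m).
Proof.
move=> hh; elim: r => [|i r IH].
  by apply: padic_poly_ext (padic_poly_const 1) => m; rewrite big_nil.
case Pi: (P i); last by apply: padic_poly_ext IH => m; rewrite big_cons Pi.
by apply: padic_poly_ext (padic_polyM (hh i) IH) => m; rewrite big_cons Pi.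
Qed.

Lemma padic_poly_det n (A : nat -> 'M[int]_n) :
  (forall i j, padic_poly (fun m => A m i j)) -> padic_poly (fun m => \det (A m)).
Proof.
move=> hA; apply: padic_poly_sum => s; apply: padic_polyM.
  exact: padic_poly_const.
exact: padic_poly_prod.
Qed.

Hypothesis p_pr : prime p.

Lemma dvdz_pfactor_mul (x y : int) k : x != 0 ->
  (p%:Z ^+ (k + logn p `|x|) %| x * y)%Z -> (p%:Z ^+ k %| y)%Z.
Proof.
move=> x0; rewrite !dvdzE !abszM !abszX /=.
have x_gt0 : (0 < `|x|)%N by rewrite absz_gt0.
have [->|y_gt0] := posnP `|y|; first by rewrite dvdn0.
rewrite !pfactor_dvdn ?muln_gt0 ?x_gt0 // lognM //.
by rewrite addnC leq_add2l.
Qed.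

(* Each zero p * m_i of F contributes a factor p * (m - m_i) to F.[p * m]. *)
Lemma horner_padic_zeros (ms : seq nat) : uniq ms ->
  exists E, forall (F : {poly int}) (k : nat),
    (k <= size ms)%N ->
    (forall m, m \in ms -> (p%:Z ^+ (k + E) %| F.[p%:Z * m%:Z])%Z) ->
  forall m, (p%:Z ^+ k %| F.[p%:Z * m%:Z])%Z.
Proof.
elim: ms => [|m1 ms IH] /=.
  by move=> _; exists 0%N => F k; rewrite leqn0 => /eqP-> _ m; rewrite expr0 dvd1z.
move=> /andP[m1ms /IH{IH}[E EP]].
pose w m := logn p `|p%:Z * (m%:Z - m1%:Z)|.
(* Dividing by p (m - m1) at another zero m loses [w m] digits of precision. The total loss depends
   on the zeros only, so it can be fixed before F is chosen. *)
exists (E + \sum_(m <- ms) w m)%N => F [|k]; first by move=> *; rewrite expr0 dvd1z.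
rewrite ltnS => kms FP m.
have /factor_theorem[G FE] : root (F - F.[p%:Z * m1%:Z]%:P) (p%:Z * m1%:Z).
  by rewrite rootE hornerD hornerN hornerC subrr.
have FG x : F.[p%:Z * x%:Z] =
    p%:Z * (x%:Z - m1%:Z) * G.[p%:Z * x%:Z] + F.[p%:Z * m1%:Z].
  have := congr1 (fun P : {poly int} => P.[p%:Z * x%:Z]) FE.
  rewrite !hornerE => /eqP; rewrite subr_eq => /eqP->.
  by ring.
have F1 : (p%:Z ^+ (k.+1 + (E + \sum_(m <- ms) w m)) %| F.[p%:Z * m1%:Z])%Z.
  by apply: FP; rewrite mem_head.
rewrite FG; apply: rpredD; last first.
  by apply: dvdz_trans F1; rewrite dvdz_exp2l // leq_addr.
rewrite exprS -mulrA dvdz_mul2l; last by rewrite eqz_nat -lt0n prime_gt0.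
apply: dvdz_mull; apply: EP => // x xms.
have xm1 : p%:Z * (x%:Z - m1%:Z) != 0.
  rewrite mulf_neq0 ?subr_eq0 ?eqz_nat -?lt0n ?prime_gt0 //.
  by apply: contraNneq m1ms => <-.
apply: (dvdz_pfactor_mul xm1).
have := FP x; rewrite in_cons xms orbT FG => /(_ isT) FPx.
have {}FPx := rpredB FPx F1; rewrite addrK in FPx.
apply: dvdz_trans FPx; rewrite dvdz_exp2l // -/(w x).
rewrite (big_rem x) //=; lia.
Qed.

(** Each zero of h forces one more factor p in every value, so s zeros contradict [h m] having
    valuation s - 1. *)
Lemma padic_poly_eq0 (h : nat -> int) : padic_poly h ->
  (forall N, exists2 m, (N <= m)%N & h m = 0) -> forall m, h m = 0.
Proof.
move=> hh freq m; apply/eqP/negPn/negP => hm0.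
pose s := (logn p `|h m|).+1.
have [ms [ums sms hms]] := frequently_seq s freq.
have [E EP] := horner_padic_zeros ums.
have [F FP] := hh (s + E)%N.
have FPz : (p%:Z ^+ s %| F.[p%:Z * m%:Z])%Z.
  apply: EP; rewrite ?sms // => x xms.
  by have := FP x; rewrite hms // sub0r rpredN.
have : (p%:Z ^+ s %| h m)%Z.
  rewrite -(subrK F.[p%:Z * m%:Z] (h m)); apply: rpredD => //.
  by apply: dvdz_trans (FP m); rewrite dvdz_exp2l // leq_addr.
rewrite dvdzE abszX /= pfactor_dvdn // ?absz_gt0 //.
by rewrite ltnn.
Qed.

End PadicPolynomial.

(** * Matrix powers as p-adic analytic functions, and Skolem-Mahler-Lech *)

Lemma logn_fact_le p n : prime p -> (logn p n`! <= n)%N.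
Proof.
move=> p_pr; rewrite logn_fact //.
(* The extra term pays for the next summand and for its own successor, as 2 (n / p^(M+1)) is at most
   n / p^M. *)
suff H M : (\sum_(1 <= k < M.+1) n %/ p ^ k + n %/ p ^ M <= n)%N.
  exact: leq_trans (leq_addr _ _) (H n).
elim: M => [|M IH]; first by rewrite big_geq // expn0 divn1.
rewrite big_nat_recr //=; apply: leq_trans IH; rewrite -addnA leq_add2l.
rewrite expnSr divnMA addnn -muln2.
apply: leq_trans (leq_divM _ p).
by rewrite leq_mul2l prime_gt1 ?orbT.
Qed.

Section PadicPowers.
Variable p : nat.
Hypothesis p_pr : prime p.

(** Of the 2i factors p, i turn the product of the m - l into the product of the p m - p l, a
    polynomial in p m. The other i cover the p-part of the factorial of i; its part w prime to p is
    inverted modulo p^K. *)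
Lemma padic_poly_bin i :
  padic_poly p (fun m => 'C(m, i)%:Z * p%:Z ^+ (2 * i)).
Proof.
move=> K.
have fi : (0 < i`!)%N := fact_gt0 i.
have [w cpw wE] := pfactor_coprime p_pr fi.
set a := logn p i`! in wE.
have ai : (a <= i)%N := logn_fact_le i p_pr.
have cz : coprimez w%:Z (p%:Z ^+ K).
  by apply: coprimezXr; rewrite coprimezE /= coprime_sym.
have [[u v] /= uv] := coprimezP _ _ cz.
exists ((u * p%:Z ^+ (i - a)) *: \prod_(l < i) ('X - (p * l)%:Z%:P)) => m.
set G := (X in X.[_]).
have GE : G.[p%:Z * m%:Z] = u * w%:Z * ('C(m, i)%:Z * p%:Z ^+ (2 * i)).
  rewrite /G hornerZ horner_prod.
  under eq_bigr do rewrite hornerXsubC PoszM -mulrBr.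
  rewrite big_split /= prodr_const card_ord.
  have -> : \prod_(l < i) (m%:Z - l%:Z) = ('C(m, i) * i`!)%:Z.
    rewrite bin_ffact.
    have [im|mi] := leqP i m; last first.
      rewrite ffact_small //.
      by apply/eqP/prodf_eq0; exists (Ordinal mi) => //; rewrite subrr.
    rewrite ffact_prod -[RHS]natz natr_prod.
    apply: eq_bigr => l _; rewrite natrB ?natz //.
    by apply: leq_trans im; apply: ltnW.
  rewrite wE !PoszM.
  have -> : (p ^ a)%N%:Z = p%:Z ^+ a by rewrite -!natz natrX.
  have -> : (2 * i)%N = (i + (i - a) + a)%N by lia.
  by rewrite !exprD; ring.
rewrite GE -[X in X - _]mul1r -mulrBl; apply: dvdz_mulr.
by rewrite -uv addrAC subrr add0r; apply: dvdz_mull.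
Qed.

Lemma mulmx1D_exp r (Y : 'M[int]_r.+1) m i j (K : nat) :
  (p%:Z ^+ K %| ((1 + (p%:Z ^+ 2) *: Y) ^+ m) i j -
    \sum_(l < K) 'C(m, l)%:Z * p%:Z ^+ (2 * l) * (Y ^+ l) i j)%Z.
Proof.
have E l : (((p%:Z ^+ 2) *: Y) ^+ l *+ 'C(m, l)) i j =
    'C(m, l)%:Z * p%:Z ^+ (2 * l) * (Y ^+ l) i j.
  rewrite exprZn -exprM mulmxnE !mxE -mulr_natl mulrA.
  by rewrite natz.
rewrite exprDn_comm; last by rewrite /GRing.comm mul1r mulr1.
under eq_bigr do rewrite expr1n mul1r.
rewrite summxE.
under eq_bigr do rewrite E.
pose F l := 'C(m, l)%:Z * p%:Z ^+ (2 * l) * (Y ^+ l) i j.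
rewrite -(big_mkord xpredT F) -[X in _ - X](big_mkord xpredT F).
have Fdvd l : (K <= l)%N -> (p%:Z ^+ K %| F l)%Z.
  move=> Kl; rewrite /F mulrAC; apply: dvdz_mull; apply: dvdz_exp2l; lia.
have [Km|mK] := leqP K m.+1.
  rewrite (big_cat_nat (leq0n K) Km) /= addrAC subrr add0r.
  by rewrite big_nat; apply: rpred_sum => l /andP[Kl _]; exact: Fdvd.
rewrite [X in _ - X](big_cat_nat (leq0n m.+1) (ltnW mK)) /= opprD addrA subrr add0r.
rewrite rpredN big_nat; apply: rpred_sum => l /andP[Kl _].
by rewrite /F bin_small // !mul0r dvdz0.
Qed.

Lemma padic_poly_mxpow r (Y : 'M[int]_r.+1) i j :
  padic_poly p (fun m => ((1 + (p%:Z ^+ 2) *: Y) ^+ m) i j).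
Proof.
move=> K.
have : padic_poly p (fun m => \sum_(l < K) 'C(m, l)%:Z * p%:Z ^+ (2 * l) * (Y ^+ l) i j).
  apply: padic_poly_sum => l; apply: padic_polyM; first exact: padic_poly_bin.
  exact: padic_poly_const.
move=> /(_ K)[F FP]; exists F => m.
rewrite -(subrK (\sum_(l < K) 'C(m, l)%:Z * p%:Z ^+ (2 * l) * (Y ^+ l) i j) (_ i j)).
rewrite -addrA; apply: rpredD; last exact: FP.
exact: mulmx1D_exp.
Qed.

(* The order of GL_r over Z/p^2 is a common period of all matrices invertible mod p. *)
Lemma mxpow_period r : exists2 N, (0 < N)%N &
  forall B : 'M[int]_r.+1, coprime p `|\det B| ->
    exists Y, B ^+ N = 1 + (p%:Z ^+ 2) *: Y.
Proof.
set q := (p ^ 2)%N.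
have q1 : (1 < q)%N by rewrite -(exp1n 2) ltn_exp2r // prime_gt1.
exists #|[set: {'GL_r.+1['Z_q]}]%SET|; first exact: cardG_gt0.
set N := #|_| => B cB.
pose phi : int -> 'Z_q := intr.
have phi0 x : phi x = 0 -> (p%:Z ^+ 2 %| x)%Z.
  have Hn n : (n%:R == 0 :> 'Z_q) -> (q %| n)%N.
    move=> /eqP/(congr1 val) /=; rewrite -[n%:R]/(n%:R : 'Z_q) Zp_nat /= Zp_cast //.
    by move=> /eqP.
  have -> : p%:Z ^+ 2 = q%:Z by rewrite /q -!natz natrX.
  rewrite /phi dvdzE /=; case: x => n /=.
    by move=> /eqP; rewrite -pmulrn => /Hn.
  by rewrite NegzE mulrNz => /eqP; rewrite oppr_eq0 -pmulrn => /Hn.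
pose Bq : 'M['Z_q]_r.+1 := map_mx phi B.
have uB : Bq \in unitmx.
  rewrite unitmxE /Bq det_map_mx /phi.
  have cq : coprime q `|\det B| by rewrite coprime_pexpl.
  case: (\det B) cq => n /=; rewrite ?NegzE ?mulrNz ?unitrN -pmulrn.
    by rewrite -[n%:R]/(n%:R : 'Z_q) unitZpE.
  by rewrite -[_%:R]/(n.+1%:R : 'Z_q) unitZpE.
pose u : {'GL_r.+1['Z_q]} := FinRing.unit 'M['Z_q]_r.+1 uB.
have uN : Bq ^+ N = 1.
  have : (u ^+ N)%g = 1%g.
    have /dvdnP[k ->] : (#[u]%g %| N)%N by apply: order_dvdG; rewrite inE.
    by rewrite mulnC expgM expg_order expg1n.
  move=> /(congr1 val); rewrite FinRing.val_unitX /=.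
  by move=> ->.
have dv i j : (p%:Z ^+ 2 %| (B ^+ N - 1) i j)%Z.
  apply: phi0; have := congr1 (fun M : 'M_r.+1 => (M - 1) i j) uN.
  rewrite subrr mxE [in RHS]mxE => H.
  rewrite -[RHS]H /Bq -rmorphXn /= !mxE /phi rmorphB /=.
  by congr (_ - _); case: eqP.
exists (\matrix_(i, j) ((B ^+ N - 1) i j %/ p%:Z ^+ 2)%Z).
apply/matrixP => i j; have := divzK (dv i j); set x := (_ %/ _)%Z => xE.
rewrite -[LHS](subrK ((1 : 'M[int]_r.+1) i j)).
have -> : (B ^+ N) i j - (1 : 'M[int]_r.+1) i j = (B ^+ N - 1) i j by rewrite [in RHS]mxE; congr (_ + _); rewrite [in RHS]mxE.
rewrite [in RHS]mxE addrC; congr (_ + _).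
by rewrite [in RHS]mxE [in RHS]mxE -/x mulrC.
Qed.

End PadicPowers.

(* Skolem-Mahler-Lech, by Hansel's p-adic argument. *)
Lemma det_exp_sum_eq_AP r (J : finType) (A B : J -> 'M[int]_r.+1) (b c : int) :
  b != 0 -> (forall j, \det (B j) != 0) ->
  (forall N, exists2 n, (N <= n)%N & \det (\sum_j A j * B j ^+ n) = c * b ^+ n) ->
  exists a N, (0 < N)%N /\ forall m,
    \det (\sum_j A j * B j ^+ (a + N * m)) = c * b ^+ (a + N * m).
Proof.
move=> b0 detB freq.
pose D := (`|b| * \prod_j `|\det (B j)|)%N.
have D0 : (0 < D)%N.
  by rewrite muln_gt0 absz_gt0 b0 prodn_gt0 // => j; rewrite absz_gt0.
(* A prime above D divides neither b nor any [\det (B j)], so all these matrices, and b as a scalar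
   matrix, have a common period modulo p^2. *)
have [p pD p_pr] := prime_above D.
have cop d : (0 < d)%N -> (d %| D)%N -> coprime p d.
  move=> d0 dD; rewrite prime_coprime //; apply/negP => /(dvdn_leq d0).
  by rewrite leqNgt (leq_ltn_trans _ pD) // dvdn_leq.
have [N N0 NP] := mxpow_period p_pr r.
have [bY bE] : exists Y : 'M[int]_r.+1, (b%:M : 'M_r.+1) ^+ N = 1 + (p%:Z ^+ 2) *: Y.
  apply: NP; rewrite det_scalar abszX coprimeXr //.
  by apply: cop; rewrite ?absz_gt0 // dvdn_mulr.
have /choice[Y YE] j : exists Y, B j ^+ N = 1 + (p%:Z ^+ 2) *: Y.
  apply: NP; apply: cop; first by rewrite absz_gt0.
  by rewrite /D (bigD1 j) //= mulnCA dvdn_mulr.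
(* Infinitely many solutions lie in one residue class modulo N, on which both sides are p-adically
   analytic. *)
have [a aP] := frequently_pigeonhole (fun n => inord (n %% N) : 'I_N.-1.+1) freq.
exists (val a), N; split=> // m.
pose h k := \det (\sum_j A j * B j ^+ (a + N * k)) - c * b ^+ (a + N * k).
suff: h m = 0 by move/eqP; rewrite subr_eq0 => /eqP.
apply: (@padic_poly_eq0 p) => //; last first.
  move=> M; have [n nM [nP an]] := aP (N * M.+1)%N.
  have nE : n = (a + N * (n %/ N))%N.
    by rewrite -an inordK ?prednK ?ltn_mod // addnC mulnC -divn_eq.
  exists (n %/ N)%N; last by rewrite /h -nE nP subrr.
  by rewrite leq_divRL //; apply: leq_trans nM; rewrite mulnC leq_mul.
have powE (M : 'M[int]_r.+1) Z i j : M ^+ N = 1 + (p%:Z ^+ 2) *: Z ->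
    padic_poly p (fun k => (M ^+ (a + N * k)) i j).
  move=> MZ; have : padic_poly p (fun k => \sum_l (M ^+ a) i l * ((1 + (p%:Z ^+ 2) *: Z) ^+ k) l j).
    apply: padic_poly_sum => l; apply: padic_polyM; first exact: padic_poly_const.
    exact: padic_poly_mxpow.
  by apply: padic_poly_ext => k; rewrite exprD exprM MZ mxE.
apply: padic_polyB.
  apply: padic_poly_det => i j.
  have : padic_poly p (fun k => \sum_J0 \sum_l A J0 i l * (B J0 ^+ (a + N * k)) l j).
    apply: padic_poly_sum => j0; apply: padic_poly_sum => l.
    by apply: padic_polyM; [exact: padic_poly_const | exact: powE (YE j0)].
  apply: padic_poly_ext => k; rewrite summxE; apply: eq_bigr => j0 _.
  by rewrite mxE.
apply: padic_polyM; first exact: padic_poly_const.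
have := powE _ _ ord0 ord0 bE; apply: padic_poly_ext => k.
by rewrite -rmorphXn mxE eqxx.
Qed.

(** * Resultants as Sylvester determinants *)

Section Vandermonde.
Variables (A : idomainType) (r : nat) (rho : 'I_r -> A).
Hypothesis rho_inj : injective rho.

Definition vdm : 'M[A]_r := \matrix_(j, k) rho k ^+ j.

Lemma det_vdm_neq0 : \det vdm != 0.
Proof.
have -> : vdm = Vandermonde r (\row_i rho i).
  by apply/matrixP => i j; rewrite !mxE.
rewrite det_Vandermonde; apply/prodf_neq0 => i _; apply/prodf_neq0 => j ij.
rewrite !mxE subr_eq0; apply: contraTneq ij => /rho_inj->.
by rewrite ltnn.
Qed.

End Vandermonde.

(* A Sylvester matrix with the formal degrees r of f and m of g. *)
Definition sylv (A : nzRingType) r m (f g : {poly A}) : 'M[A]_(r + m) :=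
  col_mx (\matrix_(i < r, j < r + m) ('X^i * g)`_j)
         (\matrix_(i < m, j < r + m) ('X^i * f)`_j).

Lemma map_sylv (A B : nzRingType) (phi : {rmorphism A -> B}) r m (f g : {poly A}) :
  map_mx phi (sylv r m f g) = sylv r m (map_poly phi f) (map_poly phi g).
Proof.
rewrite /sylv map_col_mx; congr col_mx; apply/matrixP => i j; rewrite !mxE.
  by rewrite -coef_map rmorphM /= map_polyXn.
by rewrite -coef_map rmorphM /= map_polyXn.
Qed.

(* Multiplying on the right by the evaluations at the roots of f makes the
   Sylvester matrix block triangular. *)
Lemma det_sylv (A : idomainType) r m (rho : 'I_r -> A) (f g : {poly A}) :
  injective rho -> (forall i, root f (rho i)) ->
  (size f <= r.+1)%N -> (size g <= m.+1)%N ->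
  \det (sylv r m f g) = f`_r ^+ m * \prod_i g.[rho i].
Proof.
move=> rho_inj rootf sf sg.
pose V1 : 'M[A]_(r + m, r) := \matrix_(j, k) rho k ^+ j.
(* The last m coordinate vectors complete [V1] to a square matrix with determinant that of [vdm].
   Against them the rows of f form a triangular block with diagonal f_r. *)
pose V2 : 'M[A]_(r + m, m) := \matrix_(j, k) (j == r + k :> nat)%:R.
have evalE (h : {poly A}) (i : nat) k : (size ('X^i * h)%R <= r + m)%N ->
    \sum_j ('X^i * h)`_(j : 'I_(r + m)) * V1 j k = rho k ^+ i * h.[rho k].
  move=> sh; rewrite -[rho k ^+ i]hornerXn -hornerM (horner_coef_wide _ sh).
  by apply: eq_bigr => j _; rewrite mxE.
have sX (h : {poly A}) (i : nat) n : (size h <= n.+1)%N -> (size ('X^i * h)%R <= i + n.+1)%N.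
  move=> sh; apply: leq_trans (size_polyMleq _ _) _; rewrite size_polyXn /=.
  by rewrite leq_add2l.
have detV : \det (row_mx V1 V2) = \det (vdm rho).
  have -> : row_mx V1 V2 = block_mx (vdm rho) 0 (dsubmx V1) 1%:M.
    rewrite block_mxEh -[V1 in LHS]vsubmxK -[V2 in LHS]vsubmxK; congr row_mx.
      by congr col_mx; apply/matrixP => i j; rewrite !mxE.
    congr col_mx; apply/matrixP => i j; rewrite !mxE /=.
      by rewrite ltn_eqF // (leq_trans (ltn_ord i)) ?leq_addr.
    by rewrite eqn_add2l.
  by rewrite det_lblock det1 mulr1.
apply: (mulIf (det_vdm_neq0 rho_inj)); rewrite -{1}detV -det_mulmx.
rewrite /sylv mul_col_row.
have -> : (\matrix_(i < m, j < r + m) ('X^i * f)`_j) *m V1 = 0.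
  apply/matrixP => i k; rewrite !mxE.
  under eq_bigr do rewrite mxE.
  rewrite evalE; first by rewrite (rootP (rootf k)) mulr0.
  apply: leq_trans (sX _ _ _ sf) _.
  by rewrite addnS -addSn addnC leq_add2l.
rewrite det_ublock.
have -> : (\matrix_(i < r, j < r + m) ('X^i * g)`_j) *m V1 =
    vdm rho *m diag_mx (\row_k g.[rho k]).
  apply/matrixP => i k; rewrite mul_mx_diag !mxE.
  under eq_bigr do rewrite mxE.
  rewrite evalE ?mxE //.
  by apply: leq_trans (sX _ _ _ sg) _; rewrite addnS -addSn leq_add2r.
have E (i k : 'I_m) : ((\matrix_(i < m, j < r + m) ('X^i * f)`_j) *m V2) i k =
    if (r + k < i)%N then 0 else f`_(r + k - i).
  rewrite mxE (bigD1 (rshift r k)) //= !mxE eqxx mulr1 big1 ?addr0 ?coefXnM //.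
  move=> j jk; rewrite !mxE; case: eqP => [jE|]; last by rewrite mulr0.
  by case/negP: jk; apply/eqP/val_inj.
rewrite [X in _ * X]det_trig; last first.
  apply/is_trig_mxP => i k ik; rewrite E ltnNge ltnW ?ltn_addl //=.
  by rewrite nth_default //; apply: leq_trans sf _; lia.
rewrite [X in _ * X](eq_bigr (fun=> f`_r)); last first.
  by move=> i _; rewrite E ltnNge leq_addl addnK.
rewrite [X in _ * X]prodr_const card_ord det_mulmx det_diag.
under eq_bigr do rewrite mxE.
by ring.
Qed.

(** The right-hand side is a resultant, so the Sylvester determinant over A is the witness. It is
    used over Z for norms of numbers and over Z[T] for norms of polynomials. *)
Lemma norm_integral (A : comNzRingType) (B : idomainType) (phi : {rmorphism A -> B})
    r m (rho : 'I_r -> B) (f g : {poly A}) :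
  injective rho -> (forall i, root (map_poly phi f) (rho i)) ->
  (size f <= r.+1)%N -> (size g <= m.+1)%N ->
  exists x, phi x = phi f`_r ^+ m * \prod_i (map_poly phi g).[rho i].
Proof.
move=> rho_inj rootf sf sg; exists (\det (sylv r m f g)).
rewrite -det_map_mx map_sylv (@det_sylv _ r m rho) ?coef_map //.
  by apply: leq_trans sf; exact: size_poly.
by apply: leq_trans sg; exact: size_poly.
Qed.

(** * Integer matrices representing algebraic numbers *)

Section Eval.
Variable C : comNzRingType.

Definition evalz (x : C) : {poly int} -> C := horner_eval x \o map_poly intr.
HB.instance Definition _ x := GRing.RMorphism.on (evalz x).

Lemma evalzE x a : evalz x a = (map_poly intr a).[x]. Proof. by []. Qed.

Lemma evalzX x : evalz x 'X = x.
Proof. by rewrite evalzE map_polyX hornerX. Qed.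

Lemma evalzC x c : evalz x c%:P = c%:~R.
Proof. by rewrite evalzE map_polyC hornerC. Qed.

(** An element q of Z[t][X] is read as q(t, X), with t the inner variable; [q.['X^n]] is q(t,
    t^n). *)
Lemma evalz_hornerXn x (q : {poly {poly int}}) n :
  evalz x q.['X^n] = (map_poly (evalz x) q).[x ^+ n].
Proof. by rewrite -horner_map rmorphXn /= evalzX. Qed.

Lemma evalz_wide x (a : {poly int}) n : (size a <= n)%N ->
  evalz x a = \sum_(i < n) (a`_i)%:~R * x ^+ i.
Proof.
move=> sa; rewrite evalzE (horner_coef_wide (n := n)) ?(leq_trans (size_poly _ _)) //.
by apply: eq_bigr => i _; rewrite coef_map.
Qed.

End Eval.

Section ScaledCompanion.
Variables (C : numFieldType) (r : nat) (rho : 'I_r.+1 -> C) (f : {poly int}).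
Hypothesis rho_inj : injective rho.
Hypothesis rootf : forall i, evalz (rho i) f = 0.
Hypothesis sf : (size f <= r.+2)%N.
Let c := f`_r.+1.

(** X represents an algebraic number with conjugates x_i: the column (1, rho_i, rho_i^2, ...) of
    [vdm] is an eigenvector for x_i. As the eigenvectors are common to all such X, ring operations
    act on the eigenvalues and determinants are norms. *)
Definition diagonalizes (X : 'M[int]_r.+1) (x : 'I_r.+1 -> C) :=
  map_mx intr X *m vdm rho = vdm rho *m diag_mx (\row_i x i).

Lemma diagonalizes_ext X x y : x =1 y -> diagonalizes X x -> diagonalizes X y.
Proof.
move=> xy; rewrite /diagonalizes => ->.
by congr (_ *m diag_mx _); apply/rowP => i; rewrite !mxE xy.
Qed.

Lemma diagonalizesM X Y x y : diagonalizes X x -> diagonalizes Y y ->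
  diagonalizes (X * Y) (fun i => x i * y i).
Proof.
move=> hX hY; rewrite /diagonalizes map_mxM -mulmxA hY mulmxA hX -mulmxA mulmx_diag.
by congr (_ *m diag_mx _); apply/rowP => i; rewrite !mxE.
Qed.

Lemma diagonalizesD X Y x y : diagonalizes X x -> diagonalizes Y y ->
  diagonalizes (X + Y) (fun i => x i + y i).
Proof.
move=> hX hY; rewrite /diagonalizes map_mxD mulmxDl hX hY -mulmxDr -raddfD.
by congr (_ *m diag_mx _); apply/rowP => i; rewrite !mxE.
Qed.

Lemma diagonalizes_scalar (a : int) : diagonalizes a%:M (fun=> a%:~R).
Proof.
rewrite /diagonalizes map_scalar_mx /= mul_scalar_mx -mul_mx_scalar.
congr (_ *m _); rewrite -diag_const_mx; congr diag_mx.
by apply/rowP => i; rewrite !mxE.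
Qed.

Lemma diagonalizesX X x n : diagonalizes X x ->
  diagonalizes (X ^+ n) (fun i => x i ^+ n).
Proof.
move=> hX; elim: n => [|n IH].
  exact: (diagonalizes_scalar 1).
by rewrite exprS; apply: diagonalizes_ext (diagonalizesM hX IH) => i; rewrite exprS.
Qed.

Lemma diagonalizes_sum (J : Type) (s : seq J) X x :
  (forall j, diagonalizes (X j) (x j)) ->
  diagonalizes (\sum_(j <- s) X j) (fun i => \sum_(j <- s) x j i).
Proof.
move=> hX; elim: s => [|j s IH].
  rewrite big_nil; have := diagonalizes_scalar 0; rewrite raddf0.
  by apply: diagonalizes_ext => i; rewrite big_nil.
rewrite big_cons; apply: diagonalizes_ext (diagonalizesD (hX j) IH) => i.
by rewrite big_cons.
Qed.

Lemma det_diagonalizes X x : diagonalizes X x -> (\det X)%:~R = \prod_i x i.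
Proof.
move=> /(congr1 determinant); rewrite !det_mulmx mulrC det_map_mx.
move=> /(mulfI (det_vdm_neq0 rho_inj)) ->; rewrite det_diag.
by apply: eq_bigr => i _; rewrite mxE.
Qed.

(* c times the companion matrix of f / c: it has integer entries. *)
Definition scaled_companion : 'M[int]_r.+1 :=
  \matrix_(i, j) if (i.+1 < r.+1)%N then c *+ (j == i.+1 :> nat) else - f`_j.

Lemma diagonalizes_companion : diagonalizes scaled_companion (fun i => c%:~R * rho i).
Proof.
apply/matrixP => i k; rewrite mul_mx_diag !mxE.
under eq_bigr do rewrite !mxE.
case: (ltnP i.+1 r.+1) => [ir|ri].
  rewrite (bigD1 (Ordinal ir)) //= eqxx mulr1n big1 ?addr0.
    by rewrite exprS; ring.
  move=> j ji; rewrite (_ : _ == _ = false) ?mulr0n ?mul0r //.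
  by apply: contraNF ji => /eqP ji; apply/eqP/val_inj.
have iE : i = r :> nat by apply/eqP; rewrite eqn_leq -ltnS ltn_ord.
have := rootf k; rewrite (evalz_wide _ sf) big_ord_recr /= -/c => /eqP.
rewrite addrC addr_eq0 => /eqP fk.
under eq_bigr do rewrite rmorphN mulNr.
by rewrite sumrN -fk iE exprS; ring.
Qed.

(** Puts the norms into the form required by Skolem-Mahler-Lech. The factor at rho is the sum over j
    of c^e q_j(rho) (c^d rho^j)^n; the powers of c are just enough for both parts to be integer
    polynomials in c rho. *)
Lemma det_exp_sum_norm d e (q : {poly {poly int}}) :
  (forall i, rho i != 0) -> c != 0 ->
  (size q <= d.+1)%N -> (forall j, (size (q`_j)%R <= e.+1)%N) ->
  exists A B : 'I_d.+1 -> 'M[int]_r.+1, (forall j, \det (B j) != 0) /\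
    forall n, (\det (\sum_j A j * B j ^+ n))%:~R =
      \prod_i (c%:~R ^+ (e + d * n) * evalz (rho i) q.['X^n]).
Proof.
move=> rho0 c0 sq se; set M := scaled_companion.
have cC0 : c%:~R != 0 :> C by rewrite intr_eq0.
pose A (j : 'I_d.+1) := \sum_(l < e.+1) ((q`_j)`_l * c ^+ (e - l))%:M * M ^+ l.
pose B (j : 'I_d.+1) : 'M_r.+1 := (c ^+ (d - j))%:M * M ^+ j.
have hA j : diagonalizes (A j) (fun i => c%:~R ^+ e * evalz (rho i) q`_j).
  have := diagonalizes_sum (index_enum 'I_e.+1) (fun l : 'I_e.+1 => diagonalizesM
    (diagonalizes_scalar ((q`_j)`_l * c ^+ (e - l)))
    (diagonalizesX l diagonalizes_companion)).
  apply: diagonalizes_ext => i /=; rewrite (evalz_wide _ (se j)) mulr_sumr.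
  apply: eq_bigr => l _; rewrite rmorphM rmorphXn /= exprMn.
  have -> : c%:~R ^+ e = c%:~R ^+ (e - l) * c%:~R ^+ l :> C by rewrite -exprD subnK // -ltnS.
  by ring.
have hB j : diagonalizes (B j) (fun i => c%:~R ^+ d * rho i ^+ j).
  have := diagonalizesM (diagonalizes_scalar (c ^+ (d - j)))
    (diagonalizesX j diagonalizes_companion).
  apply: diagonalizes_ext => i /=; rewrite rmorphXn /= exprMn.
  have -> : c%:~R ^+ d = c%:~R ^+ (d - j) * c%:~R ^+ j :> C by rewrite -exprD subnK // -ltnS.
  by ring.
exists A, B; split=> [j|n].
  have := det_diagonalizes (hB j) => /eqP; apply: contraTneq => ->.
  rewrite eq_sym; apply/prodf_neq0 => i _.
  by rewrite mulf_neq0 ?expf_neq0.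
have := diagonalizes_sum (index_enum 'I_d.+1) (fun j : 'I_d.+1 =>
  diagonalizesM (hA j) (diagonalizesX n (hB j))).
move=> /det_diagonalizes ->; apply: eq_bigr => i _.
rewrite evalz_hornerXn (horner_coef_wide (n := d.+1)); last first.
  exact: leq_trans (size_poly _ _) sq.
rewrite mulr_sumr; apply: eq_bigr => j _; rewrite coef_map /=.
by rewrite exprD exprMn -!exprM [(n * j)%N]mulnC; ring.
Qed.

End ScaledCompanion.

(** * Primitive minimal polynomial and conjugates *)

Section MinimalPolynomial.
Variable C : numClosedFieldType.

(** Take the primitive part of an annihilator of least degree. The multiplier k comes from
    pseudo-division over Z. *)
Lemma ex_minpoly (x : C) (a0 : {poly int}) : a0 != 0 -> evalz x a0 = 0 ->
  exists f : {poly int},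
    [/\ zcontents f = 1, evalz x f = 0,
        forall a, evalz x a = 0 -> a != 0 -> (size f <= size a)%N &
        forall a, evalz x a = 0 -> exists k h, k != 0 /\ k *: a = h * f].
Proof.
move=> a00 a0x.
have ex : exists n, `[< exists a : {poly int}, [/\ a != 0, evalz x a = 0 & size a = n] >].
  by exists (size a0); apply/asboolP; exists a0.
case: (ex_minnP ex) => n /asboolP[g [g0 gx gn]] nmin.
have smin a : evalz x a = 0 -> a != 0 -> (n <= size a)%N.
  by move=> ax aN0; apply: nmin; apply/asboolP; exists a.
pose f := zprimitive g.
have gE : g = zcontents g *: f by exact: zpolyEprim.
have cg0 : zcontents g != 0 by rewrite zcontents_eq0.
have sf : size f = n by rewrite -gn gE size_scale.
have fx : evalz x f = 0.
  move: gx; rewrite gE -mul_polyC rmorphM /= evalzC => /eqP.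
  by rewrite mulf_eq0 intr_eq0 (negPf cg0) => /eqP.
have f0 : f != 0 by apply: contraNneq g0 => f0; rewrite gE f0 scaler0.
exists f; split=> //.
- by rewrite zcontents_primitive g0.
- by move=> a; rewrite sf; exact: smin.
move=> a ax; exists (lead_coef f ^+ Pdiv.Idomain.scalp a f), (a %/ f)%R.
split; first by rewrite expf_neq0 ?lead_coef_eq0.
rewrite Pdiv.Idomain.divp_eq.
suff -> : (a %% f)%R = 0 by rewrite addr0.
apply: contrapT => /eqP m0; have := @Pdiv.Idomain.ltn_modp _ a f.
rewrite f0 ltnNge sf smin //.
have := congr1 (evalz x) (Pdiv.Idomain.divp_eq a f).
by rewrite -mul_polyC !(rmorphM, rmorphD) /= fx ax !mulr0 add0r.
Qed.

(** This is the irreducibility of f. If b is minimal for y, then l f = g b; by degree g cannot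
    vanish at x, so b does. *)
Lemma minpoly_conj (x y : C) (f : {poly int}) : evalz x f = 0 ->
  (forall a, evalz x a = 0 -> a != 0 -> (size f <= size a)%N) ->
  (forall a, evalz x a = 0 -> exists k h, k != 0 /\ k *: a = h * f) ->
  f != 0 -> evalz y f = 0 -> forall a, evalz y a = 0 <-> evalz x a = 0.
Proof.
move=> fx fmin fdvd f0 fy.
have cancel_scale (z : C) k (a : {poly int}) : k != 0 -> evalz z (k *: a) = 0 -> evalz z a = 0.
  move=> k0; rewrite -mul_polyC rmorphM /= evalzC => /eqP.
  by rewrite mulf_eq0 intr_eq0 (negPf k0) => /eqP.
have [b [_ fb bmin bdvd]] := ex_minpoly f0 fy.
move=> a; split=> [ay|/fdvd[k [h [k0 kE]]]]; last first.
  by apply: (cancel_scale _ k) => //; rewrite kE rmorphM /= fy mulr0.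
have [k [h [k0 kE]]] := bdvd _ ay.
have [l [g [l0 lE]]] := bdvd _ fy.
have gb0 : g * b != 0 by rewrite -lE scale_poly_eq0 negb_or l0.
have [g0 b0] : g != 0 /\ b != 0 by move: gb0; rewrite mulf_eq0 negb_or => /andP.
have sb : (1 < size b)%N.
  rewrite ltnNge; apply/negP => /size1_polyC bE.
  by move: fb; rewrite bE evalzC => /eqP; rewrite intr_eq0 -polyC_eq0 -bE (negPf b0).
suff bx : evalz x b = 0.
  by apply: (cancel_scale _ k) => //; rewrite kE rmorphM /= bx mulr0.
have : evalz x (g * b) = 0 by rewrite -lE -mul_polyC rmorphM /= fx mulr0.
rewrite rmorphM /= => /eqP; rewrite mulf_eq0 => /orP[/eqP gx|/eqP//].
have := fmin g gx g0; rewrite -(size_scale f l0) lE size_mul //.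
by case: (size b) sb => [|[|s]] //= _; rewrite !addnS /= leqNgt ltnS leq_addr.
Qed.

Lemma ex_conjugates (x : C) (a0 : {poly int}) : a0 != 0 -> evalz x a0 = 0 ->
  exists (f : {poly int}) r (rho : 'I_r.+1 -> C),
    [/\ zcontents f = 1, size f = r.+2, injective rho,
        map_poly intr f = (f`_r.+1)%:~R *: \prod_i ('X - (rho i)%:P) &
        forall a i, evalz (rho i) a = 0 <-> evalz x a = 0].
Proof.
move=> a00 a0x; have [f [cf fx fmin fdvd]] := ex_minpoly a00 a0x.
have f0 : f != 0 by apply: contra_eqN cf => /eqP->; rewrite zcontents0.
have sf : (1 < size f)%N.
  rewrite ltnNge; apply/negP => /size1_polyC fE.
  by move: fx; rewrite fE evalzC => /eqP; rewrite intr_eq0 -polyC_eq0 -fE (negPf f0).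
have sfC : size (map_poly intr f : {poly C}) = size f.
  by apply: size_map_inj_poly => //; exact: intr_inj.
have lfC : lead_coef (map_poly intr f : {poly C}) = (lead_coef f)%:~R.
  by apply: lead_coef_map_inj => //; exact: intr_inj.
have [rs rsE] := closed_field_poly_normal (map_poly intr f : {poly C}).
have rootf y : y \in rs -> evalz y f = 0.
  by move=> yrs; apply/rootP; rewrite rsE rootZ ?root_prod_XsubC // lfC intr_eq0 lead_coef_eq0.
have conj y : y \in rs -> forall a, evalz y a = 0 <-> evalz x a = 0.
  by move=> /rootf fy; exact: (minpoly_conj fx fmin fdvd).
(* The derivative is non-zero of smaller degree, so by minimality it vanishes at no root of f: the
   roots are simple. *)
have df0 : f^`() != 0.
  apply/negP => /eqP/(congr1 (fun a : {poly int} => a`_(size f).-2)).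
  rewrite coef0 coef_deriv prednK; last by case: (size f) sf => [|[]].
  move=> /eqP; rewrite mulrn_eq0 -lead_coefE lead_coef_eq0 (negPf f0) orbF.
  by case: (size f) sf => [|[]].
have urs : uniq rs.
  rewrite -separable_prod_XsubC separable_poly.unlock.
  apply/Pdiv.ClosedField.coprimepP => y; rewrite root_prod_XsubC => yrs; apply/eqP => dy.
  have dfy : evalz y f^`() = 0.
    by rewrite evalzE -deriv_map rsE derivZ hornerZ dy mulr0.
  by have := fmin f^`() ((conj y yrs _).1 dfy) df0; rewrite leqNgt lt_size_deriv.
have srs : size rs = (size f).-1.
  by rewrite -sfC rsE size_scale ?lfC ?intr_eq0 ?lead_coef_eq0 // size_prod_XsubC.
case: rs urs srs rsE conj {rootf} => [|y0 rs] urs srs rsE conj.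
  by move: sf srs; case: (size f) => [|[]].
have sfE : size f = (size rs).+2 by case: (size f) sf srs => [|[|s]] //= _ [->].
exists f, (size rs), (fun i => (y0 :: rs)`_i); split=> //.
- by move=> i j /eqP; rewrite nth_uniq //= => /eqP/val_inj.
- rewrite rsE lfC lead_coefE sfE /=; congr (_ *: _).
  by rewrite (big_nth 0) big_mkord.
- by move=> a i; apply: conj; rewrite mem_nth.
Qed.
End MinimalPolynomial.

(** * Simultaneous recurrence on the unit circle, and Kronecker's theorem *)

Section Recurrence.
Variable R : realType.
Local Notation Re := (@complex.Re R).
Local Notation Im := (@complex.Im R).

Lemma same_truncn_close (K x y : R) : 0 < K -> -1 <= x -> -1 <= y ->
  Num.truncn (K * (x + 1)) = Num.truncn (K * (y + 1)) -> (x - y) ^+ 2 <= (K^-1) ^+ 2.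
Proof.
move=> K0 x1 y1 E.
have := truncn_itv (x := K * (x + 1)); have := truncn_itv (x := K * (y + 1)).
rewrite !mulr_ge0 ?(ltW K0) //; try lra.
rewrite E -natr1 => /(_ isT)/andP[a b] /(_ isT)/andP[c d].
have Kxy : (K * (x - y)) ^+ 2 <= 1 by nra.
have -> : x - y = K^-1 * (K * (x - y)) by rewrite mulKf ?gt_eqF.
by rewrite exprMn ler_piMr ?sqr_ge0.
Qed.

(** Dirichlet's pigeonhole on a torus: two powers n1 < n2 put all z_i in the same cells, and
    dividing by z_i^n1, of modulus 1, shows that n2 - n1 works. *)
Lemma unit_recurrence r (z : 'I_r -> R[i]) (eps : R[i]) :
  (forall i, `|z i| = 1) -> 0 < eps ->
  exists2 m, (0 < m)%N & forall i, `|z i ^+ m - 1| < eps.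
Proof.
move=> z1 eps0; set e := Re eps.
have [epsE e0] : eps = e%:C%C /\ 0 < e.
  have := eps0; rewrite ltcE /= => /andP[/eqP im re]; split=> //.
  by apply/eqP; rewrite eq_complex /= im !eqxx.
have norm1 (w : R[i]) : `|w| = 1 -> Re w ^+ 2 + Im w ^+ 2 = 1.
  move=> w1; have := add_Re2_Im2 w; rewrite w1 expr1n => /eqP.
  by rewrite eq_complex /= eqxx andbT => /eqP.
have zn i n : `|z i ^+ n| = 1 by rewrite normrX z1 expr1n.
(* Mesh 1/k below e/2 in both coordinates gives a squared distance below e^2 / 2. *)
pose K : nat := Num.truncn (2 / e); pose k := K.+1%:R : R.
have k0 : 0 < k by rewrite ltr0n.
have ke : k^-1 < e / 2.
  have : 2 / e < k by exact: truncnS_gt.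
  by rewrite -[e / 2]invf_div ltf_pV2 ?posrE ?divr_gt0.
pose cell (x : R) : 'I_(2 * K.+1).+1 := inord (Num.truncn (k * (x + 1))).
have cell_close x y : x ^+ 2 <= 1 -> y ^+ 2 <= 1 -> cell x = cell y ->
    (x - y) ^+ 2 <= (k^-1) ^+ 2.
  move=> x1 y1 /(congr1 val); rewrite /= !inordK.
  - by apply: same_truncn_close => //; nra.
  - rewrite ltnS truncn_le_nat (@le_lt_trans _ _ (2 * K.+1)%:R) ?ltr_nat //.
    rewrite natrM mulrC ler_wpM2r ?(ltW k0) //; nra.
  - rewrite ltnS truncn_le_nat (@le_lt_trans _ _ (2 * K.+1)%:R) ?ltr_nat //.
    rewrite natrM mulrC ler_wpM2r ?(ltW k0) //; nra.
pose col n := [ffun i => (cell (Re (z i ^+ n)), cell (Im (z i ^+ n)))].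
have [|c cP] := @frequently_pigeonhole _ (fun=> True) col; first by move=> N; exists N.
have [n1 _ [_ c1]] := cP 0%N.
have [n2 n12 [_ c2]] := cP n1.+1.
exists (n2 - n1)%N => [|i]; first by rewrite subn_gt0.
have -> : `|z i ^+ (n2 - n1) - 1| = `|z i ^+ n2 - z i ^+ n1|.
  have -> : z i ^+ n2 = z i ^+ (n2 - n1) * z i ^+ n1 by rewrite -exprD subnK // ltnW.
  by rewrite -[X in _ = `|_ - X|]mul1r -mulrBl normrM zn mulr1.
have /ffunP/(_ i) := etrans c2 (esym c1); rewrite !ffunE => -[cr ci].
have u1 := norm1 _ (zn i n1); have u2 := norm1 _ (zn i n2).
have hr := cell_close _ _ _ _ cr; have hi := cell_close _ _ _ _ ci.
rewrite -(ltr_pXn2r (n := 2)) // ?nnegrE ?(ltW eps0) //.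
rewrite -add_Re2_Im2 epsE -rmorphXn ltcR !raddfB /=.
have := sqr_ge0 (Re (z i ^+ n1)); have := sqr_ge0 (Im (z i ^+ n1)).
have := sqr_ge0 (Re (z i ^+ n2)); have := sqr_ge0 (Im (z i ^+ n2)).
move=> p1 p2 p3 p4.
have {}hr : (Re (z i ^+ n2) - Re (z i ^+ n1)) ^+ 2 <= (k^-1) ^+ 2 by apply: hr; lra.
have {}hi : (Im (z i ^+ n2) - Im (z i ^+ n1)) ^+ 2 <= (k^-1) ^+ 2 by apply: hi; lra.
have kk : (k^-1) ^+ 2 < (e / 2) ^+ 2.
  by rewrite ltr_pXn2r // nnegrE ?invr_ge0 ?divr_ge0 ?(ltW e0) ?(ltW k0).
have e2 : 0 < e ^+ 2 by rewrite exprn_gt0.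
have e4 : (e / 2) ^+ 2 = e ^+ 2 / 4 by field.
apply: (le_lt_trans (lerD hr hi)); move: kk e2; rewrite e4.
by move: (k^-1 ^+ 2) (e ^+ 2) => t u tu u0; lra.
Qed.

(* Kronecker: the integer [\prod_i (rho_i ^ m - 1)] is less than 1 in modulus
   as soon as rho_i ^ m is close to 1 for the rho_i on the unit circle. *)
Lemma kronecker (x : R[i]) (f : {poly int}) r (rho : 'I_r.+1 -> R[i]) :
  `|x| = 1 -> injective rho -> (size f <= r.+2)%N -> `|f`_r.+1| = 1 ->
  (forall a i, evalz (rho i) a = 0 <-> evalz x a = 0) ->
  evalz x f = 0 -> (exists i, rho i = x) -> (forall i, `|rho i| <= 1) ->
  exists2 m, (0 < m)%N & x ^+ m = 1.
Proof.
move=> x1 rho_inj sf lf conj fx [i0 rhoi0] rho1.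
(* Roots inside the disc need no control; 1 is a harmless stand-in on the unit circle. *)
pose z i := if `|rho i| == 1 then rho i else 1.
have z1 i : `|z i| = 1 by rewrite /z; case: ifP => [/eqP//|]; rewrite normr1.
(* The r factors other than the one at x have modulus at most 2 each. *)
have eps0 : 0 < (2 ^+ r)^-1 :> R[i] by rewrite invr_gt0 exprn_gt0 ?ltr0n.
have [m m0 mP] := unit_recurrence z1 eps0.
exists m => //; pose g : {poly int} := 'X^m - 1.
have gE (y : R[i]) : evalz y g = y ^+ m - 1.
  by rewrite rmorphB rmorphXn /= evalzX rmorph1.
have [|||n nE] := @norm_integral _ _ (intr : int -> R[i]) _ m rho f g rho_inj.
- by move=> i; apply/rootP/conj.
- by [].
- by rewrite (leq_trans (size_polyD _ _)) // size_polyN size_polyXn size_poly1 geq_max leqnn.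
have nlt1 : `|n| < 1.
  rewrite -(ltr_int R[i]) intr_norm nE normrM normrX -intr_norm lf expr1n mul1r.
  rewrite normr_prod (bigD1 i0) //= -evalzE gE.
  have le2 i : `|evalz (rho i) g| <= 2.
    rewrite gE (le_trans (ler_normB _ _)) // normr1 normrX -[2]/(1 + 1) lerD2r.
    by rewrite exprn_ile1.
  apply: (@le_lt_trans _ _ (`|rho i0 ^+ m - 1| * 2 ^+ r)).
    rewrite ler_wpM2l //.
    have -> : 2 ^+ r = \prod_(i < r.+1 | i != i0) (2 : R[i]).
      by rewrite prodr_const cardC1 card_ord.
    by apply: ler_prod => i _; rewrite normr_ge0 -evalzE le2.
  rewrite -ltr_pdivlMr ?exprn_gt0 ?ltr0n // div1r.
  by have := mP i0; rewrite /z rhoi0 x1 eqxx.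
have n0 : n = 0 by lia.
move: nE; rewrite n0 rmorph0 => /esym/eqP; rewrite mulf_eq0 expf_eq0 intr_eq0.
case: eqP lf => [->|_ _]; first by rewrite normr0.
rewrite andbF /= => /prodf_eq0[i _]; rewrite -evalzE => /eqP/conj.
by rewrite gE => /eqP; rewrite subr_eq0 => /eqP.
Qed.

End Recurrence.

(** * Elimination, and descent of the coefficients to Z[eta] *)

Lemma sylv_mul (A : comNzRingType) r m (f g : {poly A}) (v : 'rV[A]_(r + m)) :
  let U := \poly_(i < r) (if insub i is Some i' then v 0 (lshift m i') else 0) in
  let V := \poly_(i < m) (if insub i is Some i' then v 0 (rshift r i') else 0) in
  forall j, (v *m sylv r m f g) 0 j = (U * g + V * f)`_j.
Proof.
move=> U V j; rewrite /U /V !poly_def coefD !mulr_suml !coef_sum.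
rewrite mxE big_split_ord /=; congr (_ + _); apply: eq_bigr => i _.
  by rewrite col_mxEu mxE valK -scalerAl coefZ.
by rewrite col_mxEd mxE valK -scalerAl coefZ.
Qed.

Lemma size_mul_le (A : nzRingType) r m (U g : {poly A}) :
  (size U <= r)%N -> (size g <= m.+1)%N -> (size (U * g)%R <= r + m)%N.
Proof.
move=> sU sg; apply: leq_trans (size_polyMleq _ _) _.
by rewrite -subn1 leq_subLR add1n -addnS leq_add.
Qed.

(** The pair (U, V) is row j of the adjugate. All powers of X below r + m are reached, not only 1,
    and [norm_dvd_fixed] uses every one of them. *)
Lemma sylv_bezout (A : comNzRingType) r m (f g : {poly A}) (j : 'I_(r + m)) :
  (size f <= r.+1)%N -> (size g <= m.+1)%N ->
  exists U V : {poly A}, [/\ (size U <= r)%N, (size V <= m)%N &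
    U * g + V * f = (\det (sylv r m f g))%:P * 'X^j].
Proof.
move=> sf sg; pose v := row j (\adj (sylv r m f g)).
have := sylv_mul f g v; set U := \poly_(i < r) _; set V := \poly_(i < m) _ => /= UV.
have sU : (size U <= r)%N by exact: size_poly.
have sV : (size V <= m)%N by exact: size_poly.
exists U, V; split=> //; apply/polyP => l.
have [lrm|rml] := ltnP l (r + m); last first.
  rewrite nth_default; last first.
    apply: leq_trans rml; apply: leq_trans (size_polyD _ _) _; rewrite geq_max.
    by rewrite size_mul_le //= addnC size_mul_le.
  by rewrite coefCM coefXn gtn_eqF ?mulr0 // (leq_trans _ rml).
rewrite -(UV (Ordinal lrm)) /v -row_mul mul_adj_mx !mxE coefCM coefXn.
by rewrite -val_eqE /= [l == _]eq_sym mulr_natr.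
Qed.

(** A kernel vector is a relation U g = - V f with U and V of degree below d. The condition on exact
    sizes excludes a common zero at infinity, where the formal resultant would vanish. *)
Lemma det_sylv_neq0 (F : fieldType) d (f g : {poly F}) : coprimep f g ->
  (size f <= d.+1)%N -> (size g <= d.+1)%N -> (size f = d.+1 \/ size g = d.+1) ->
  \det (sylv d d f g) != 0.
Proof.
move=> cfg sf sg sfg; apply/negP => /det0P[v v0 vS].
have := sylv_mul f g v; set U := \poly_(i < d) _; set V := \poly_(i < d) _ => /= UV.
have sU : (size U <= d)%N by exact: size_poly.
have sV : (size V <= d)%N by exact: size_poly.
have UV0 : U * g + V * f = 0.
  apply/polyP => l; have [ld|dl] := ltnP l (d + d).
    by rewrite -(UV (Ordinal ld)) vS mxE coef0.
  rewrite coef0 nth_default //.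
  apply: leq_trans dl; apply: leq_trans (size_polyD _ _) _; rewrite geq_max.
  by rewrite !size_mul_le.
have UgE : U * g = - V * f by apply/eqP; rewrite mulNr -addr_eq0 UV0.
have [U0 V0] : U = 0 /\ V = 0.
  case: sfg => s.
    have U0 : U = 0.
      apply/eqP/contraT => U0; have : dvdp f U.
        by rewrite -(Gauss_dvdpl _ cfg) UgE dvdp_mull.
      by move=> /(dvdp_leq U0); rewrite s leqNgt ltnS sU.
    split=> //; apply/eqP; move: UV0; rewrite U0 mul0r add0r => /eqP.
    by rewrite mulf_eq0 -[f == 0]size_poly_eq0 s orbF.
  have V0 : V = 0.
    apply/eqP/contraT => V0; have : dvdp g (- V).
      by rewrite -(@Gauss_dvdpl _ _ f g) 1?coprimep_sym // -UgE dvdp_mull.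
    by rewrite dvdpNr => /(dvdp_leq V0); rewrite s leqNgt ltnS sV.
  split=> //; apply/eqP; move: UV0; rewrite V0 mul0r addr0 => /eqP.
  by rewrite mulf_eq0 -[g == 0]size_poly_eq0 s orbF.
case/eqP: v0; apply/rowP => i; rewrite mxE -(splitK i).
case: (split i) => l /=.
  have := congr1 (fun W : {poly F} => W`_l) U0.
  by rewrite /= coef0 coef_poly ltn_ord valK.
have := congr1 (fun W : {poly F} => W`_l) V0.
by rewrite /= coef0 coef_poly ltn_ord valK.
Qed.

(** P q - Q p has degree at most 2d and more than 2d zeros, so it is 0. By Bezout (p, q) = h (P, Q),
    and h is constant because P or Q already has degree d. *)
Lemma proportional_fractions (F : fieldType) d (P Q p q : {poly F}) (s : seq F) :
  coprimep P Q -> (size P = d.+1 \/ size Q = d.+1) ->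
  (size P <= d.+1)%N -> (size Q <= d.+1)%N ->
  (size p <= d.+1)%N -> (size q <= d.+1)%N ->
  uniq s -> (d + d < size s)%N ->
  (forall x, x \in s -> exists k, P.[x] = k * Q.[x] /\ p.[x] = k * q.[x]) ->
  exists c, p = c *: P /\ q = c *: Q.
Proof.
move=> cPQ sPQ sP sQ sp sq us sd ks.
have PqQp : P * q = Q * p.
  apply/eqP; rewrite -subr_eq0; apply: contraTT sd => D0; rewrite -leqNgt.
  rewrite -ltnS; apply: leq_trans (max_poly_roots D0 _ us) _.
    apply/allP => x /ks[k [Px px]]; apply/rootP.
    by rewrite hornerD hornerN !hornerM Px px; ring.
  apply: leq_trans (size_polyD _ _) _; rewrite size_polyN geq_max -addSn.
  by rewrite !size_mul_le.
have [[u v] /= uv] := Bezout_eq1_coprimepP _ _ cPQ.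
pose h := u * p + v * q.
have pE : p = h * P.
  by rewrite -[LHS]mul1r -uv /h !mulrDl -!mulrA [q * P]mulrC PqQp; ring.
have qE : q = h * Q.
  by rewrite -[LHS]mul1r -uv /h !mulrDl -!mulrA [p * Q]mulrC -PqQp; ring.
have sh : (size h <= 1)%N.
  have [->|h0] := eqVneq h 0; first by rewrite size_poly0.
  have hs (W : {poly F}) : size W = d.+1 -> (size (h * W)%R <= d.+1)%N -> (size h <= 1)%N.
    move=> sW; have W0 : W != 0 by rewrite -size_poly_gt0 sW.
    by rewrite size_mul // sW addnS /= -[X in (_ <= X)%N]add1n leq_add2r.
  by case: sPQ => s1; apply: (hs _ s1); rewrite -?pE -?qE.
by exists h`_0; rewrite -!mul_polyC -(size1_polyC sh).
Qed.

Section Descent.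
Variables (C : numFieldType) (eta : C) (d : nat) (P Q : {poly C}).
Variables (S : nat -> Prop) (k : nat -> int).
Hypothesis eta_inj : injective (fun n => eta ^+ n).
Hypothesis cPQ : coprimep P Q.
Hypotheses (sP : (size P <= d.+1)%N) (sQ : (size Q <= d.+1)%N).
Hypothesis sPQ : size P = d.+1 \/ size Q = d.+1.
Hypothesis freqS : forall N, exists2 n, (N <= n)%N & S n.
Hypothesis Sk : forall n, S n -> P.[eta ^+ n] = (k n)%:~R * Q.[eta ^+ n].

(* The linear system p(eta^n) = k_n q(eta^n), for 2d+1 values of n, has
   coefficients in Z[eta] and a one-dimensional space of solutions, spanned by
   (P, Q). Replacing one more equation by the j-th coordinate form makes it
   invertible, and a row of its adjugate is a solution over Z[eta]. *)
Lemma descent : exists (p q : {poly {poly int}}) (c : C),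
  [/\ c != 0, (size p <= d.+1)%N, (size q <= d.+1)%N,
      map_poly (evalz eta) p = c *: P & map_poly (evalz eta) q = c *: Q].
Proof.
pose N := (d.+1 + d.+1)%N.
have [n [n_inj nS]] : exists n : 'I_N -> nat, injective n /\ forall i, S (n i).
  have [ms [ums sms hms]] := frequently_seq N freqS.
  exists (fun i => nth 0%N ms i); split=> [i j|i].
    by move=> /eqP; rewrite nth_uniq ?sms // => /eqP/val_inj.
  by apply: hms; rewrite mem_nth ?sms.
pose vec (A : nzRingType) (p q : {poly A}) : 'rV[A]_N :=
  \row_l match split l with inl a => p`_a | inr b => q`_b end.
pose fstp (A : nzRingType) (v : 'rV[A]_N) : {poly A} :=
  \poly_(i < d.+1) v 0 (lshift d.+1 (inord i)).
pose sndp (A : nzRingType) (v : 'rV[A]_N) : {poly A} :=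
  \poly_(i < d.+1) v 0 (rshift d.+1 (inord i)).
have [j vj] : exists j, vec _ P Q 0 j != 0.
  have Hn (W : {poly C}) : size W = d.+1 -> W`_d != 0.
    by move=> sW; rewrite -[d]/(d.+1.-1) -sW -lead_coefE lead_coef_eq0 -size_poly_gt0 sW.
  case: sPQ => /Hn W0.
    by exists (lshift d.+1 ord_max); rewrite mxE (unsplitK (inl _)).
  by exists (rshift d.+1 ord_max); rewrite mxE (unsplitK (inr _)).
pose i0 : 'I_N := ord_max.
pose M : 'M[{poly int}]_N := \matrix_(l, i)
  if i == i0 then (l == j)%:R else
  match split l with inl a => 'X^(n i * a) | inr b => - (k (n i))%:P * 'X^(n i * b) end.
pose MC := map_mx (evalz eta) M.
have MCE (v : 'rV[C]_N) i : i != i0 ->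
    (v *m MC) 0 i = (fstp _ v).[eta ^+ n i] - (k (n i))%:~R * (sndp _ v).[eta ^+ n i].
  move=> ii0; rewrite mxE big_split_ord /= !horner_poly mulr_sumr -sumrN.
  congr (_ + _); apply: eq_bigr => l _; rewrite !mxE (negPf ii0).
    by rewrite (unsplitK (inl _)) rmorphXn /= evalzX inord_val exprM.
  rewrite (unsplitK (inr _)) rmorphM rmorphN rmorphXn /= evalzX evalzC inord_val exprM.
  by ring.
have MC0 (v : 'rV[C]_N) : (v *m MC) 0 i0 = v 0 j.
  rewrite mxE (bigD1 j) //= !mxE !eqxx rmorph1 mulr1 big1 ?addr0 // => l lj.
  by rewrite !mxE eqxx (negPf lj) rmorph0 mulr0.
have vecK (v : 'rV[C]_N) : v = vec _ (fstp _ v) (sndp _ v).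
  apply/rowP => l; rewrite mxE -[in LHS](splitK l); case: (split l) => a /=.
    by rewrite coef_poly ltn_ord inord_val.
  by rewrite coef_poly ltn_ord inord_val.
have prop (v : 'rV[C]_N) : (forall i, i != i0 -> (v *m MC) 0 i = 0) ->
    exists c, fstp _ v = c *: P /\ sndp _ v = c *: Q.
  move=> v0; pose s := [seq eta ^+ n i | i <- enum (predC1 i0)].
  apply: (@proportional_fractions _ d _ _ _ _ s) => //; try exact: size_poly.
  - by rewrite map_inj_uniq ?enum_uniq // => a b /eta_inj/n_inj.
  - by rewrite size_map -cardE cardC1 card_ord /N; lia.
  move=> x xs; have [i + ->] := elimT seq.mapP xs; rewrite mem_enum inE => ii0; exists (k (n i))%:~R.
  split; first exact: Sk.
  by apply/eqP; rewrite -subr_eq0 -MCE // v0.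
have vecZ c : vec _ (c *: P) (c *: Q) = c *: vec _ P Q.
  by apply/rowP => l; rewrite !mxE; case: split => a; rewrite coefZ.
have detMC : \det MC != 0.
  apply/negP => /det0P[v v0 vMC].
  have [|c [fE sE]] := prop v; first by move=> i _; rewrite vMC mxE.
  have vE : v = c *: vec _ P Q by rewrite [v]vecK fE sE vecZ.
  have := MC0 v; rewrite vMC vE !mxE => /esym/eqP.
  rewrite -[X in c * X]/(_) mulf_eq0; move: vj; rewrite mxE => /negPf->.
  by rewrite orbF => /eqP c0; move: v0; rewrite vE c0 scale0r eqxx.
pose w := row i0 (\adj M).
have wM : map_mx (evalz eta) w *m MC = \row_i (\det MC *+ (i0 == i)).
  rewrite -map_mxM /w -row_mul mul_adj_mx; apply/rowP => i.
  by rewrite !mxE rmorphMn /= det_map_mx.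
have [i ii0|c [fE sE]] := prop (map_mx (evalz eta) w).
  by rewrite wM mxE eq_sym (negPf ii0).
have mapp (u : 'rV[{poly int}]_N) : (map_poly (evalz eta) (fstp _ u) = fstp _ (map_mx (evalz eta) u)).
  by apply/polyP => l; rewrite coef_map /= !coef_poly; case: ifP => _; [rewrite mxE | exact: rmorph0].
have mapq (u : 'rV[{poly int}]_N) : (map_poly (evalz eta) (sndp _ u) = sndp _ (map_mx (evalz eta) u)).
  by apply/polyP => l; rewrite coef_map /= !coef_poly; case: ifP => _; [rewrite mxE | exact: rmorph0].
exists (fstp _ w), (sndp _ w), c; split; rewrite ?mapp ?mapq //; try exact: size_poly.
(* The j-th coordinate of the solution [w] at eta is [\det MC], so c = 0 would make it vanish. *)
apply: contraNneq detMC => c0.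
have := MC0 (map_mx (evalz eta) w); rewrite wM mxE eqxx mulr1n => ->.
by rewrite [map_mx _ w]vecK fE sE vecZ c0 scale0r mxE.
Qed.

End Descent.

(** * Divisibility of a fixed integer by the norms *)

Definition csize (q : {poly {poly int}}) := \max_(l < size q) size (q`_l)%R.

Lemma size_coef_le (q : {poly {poly int}}) l : (size (q`_l)%R <= csize q)%N.
Proof.
have [lq|ql] := ltnP l (size q); last by rewrite nth_default // size_poly0.
exact: (leq_bigmax (F := fun i : 'I_(size q) => size (q`_i)%R) (Ordinal lq)).
Qed.

Lemma size_hornerXn (q : {poly {poly int}}) d e n :
  (size q <= d.+1)%N -> (forall l, (size (q`_l)%R <= e.+1)%N) ->
  (size (q.['X^n])%R <= (e + d * n).+1)%N.
Proof.
move=> sq se; rewrite (horner_coef_wide (n := d.+1)) //.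
apply: leq_trans (size_sum _ _ _) _; apply/bigmax_leqP => i _.
rewrite -exprM; apply: leq_trans (size_polyMleq _ _) _.
rewrite size_polyXn addnS /= -addSn leq_add // mulnC leq_mul2r.
by rewrite -ltnS ltn_ord orbT.
Qed.

Section ConjugateNorm.
Variables (C : numClosedFieldType) (f : {poly int}) (r : nat) (rho : 'I_r.+1 -> C).
Hypothesis cf : zcontents f = 1.
Hypothesis sf : size f = r.+2.
Hypothesis rho_inj : injective rho.
Hypothesis fE : map_poly intr f = (f`_r.+1)%:~R *: \prod_i ('X - (rho i)%:P).
Local Notation a := (f`_r.+1).

Lemma conj_lead_neq0 : a != 0.
Proof. by rewrite -[r.+1]/(r.+2.-1) -sf -lead_coefE lead_coef_eq0 -size_poly_gt0 sf. Qed.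

Lemma conj_rootf i : root (map_poly intr f) (rho i).
Proof.
rewrite fE rootE hornerZ horner_prod (bigD1 i) //= hornerXsubC subrr.
by rewrite mul0r mulr0.
Qed.

Lemma conj_norm (g : {poly int}) m : (size g <= m.+1)%N ->
  exists N : int, N%:~R = a%:~R ^+ m * \prod_i evalz (rho i) g.
Proof.
move=> sg; have [||N NE] := @norm_integral _ _ (intr : int -> C) _ m rho f g rho_inj conj_rootf.
- by rewrite sf.
- exact: sg.
by exists N.
Qed.

(* The relations [g W_l = c t^l] combine into [g W(T) = c (T - t)^L]; taking
   norms, Gauss's lemma applies to the primitive polynomial f(T)^L. *)
Lemma conj_norm_dvd (g c : {poly int}) (W : nat -> {poly int}) D m L s N M :
  (forall l, (l <= L)%N -> (size (W l) <= m.+1)%N) ->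
  (forall i l, (l <= L)%N -> evalz (rho i) (g * W l) = evalz (rho i) (c * 'X^l)) ->
  (L <= D + m)%N ->
  N%:~R = a%:~R ^+ D * \prod_i evalz (rho i) g ->
  M%:~R = a%:~R ^+ s * \prod_i evalz (rho i) c ->
  (N %| M * a ^+ (D + m - L))%Z.
Proof.
move=> sW gW LDm NE ME.
(* The sum of the b_l(T) t^l is (T - t)^L. In [Wt] the outer variable is t and the coefficients lie
   in Z[T]. *)
pose b l : {poly int} := ((-1) ^+ l * 'C(L, l)%:R) *: 'X^(L - l).
pose Wt : {poly {poly int}} := \sum_(l < L.+1) (b l)%:P * map_poly polyC (W l).
pose phi := map_poly (intr : int -> C).
have [||||x xE] := @norm_integral _ _ phi _ m (fun i => (rho i)%:P) (map_poly polyC f) Wt.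
- by move=> i j /polyC_inj/rho_inj.
- move=> i; have -> : map_poly phi (map_poly polyC f) = map_poly polyC (phi f).
    by rewrite -!map_poly_comp; apply: eq_map_poly => z /=; rewrite /phi map_polyC.
  by apply/rootP; rewrite horner_map (rootP (conj_rootf i)).
- by rewrite size_map_polyC sf.
- apply: leq_trans (size_sum _ _ _) _; apply/bigmax_leqP => l _.
  apply: leq_trans (size_polyMleq _ _) _.
  rewrite -subn1 leq_subLR; apply: (leq_add (size_polyC_leq1 _)).
  by rewrite size_map_polyC sW // -ltnS.
have key i : (evalz (rho i) g)%:P * (map_poly phi Wt).[(rho i)%:P] =
    (evalz (rho i) c)%:P * ('X - (rho i)%:P) ^+ L.
  rewrite /Wt rmorph_sum horner_sum mulr_sumr exprBn mulr_sumr.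
  apply: eq_bigr => l _; rewrite rmorphM hornerM /= map_polyC hornerC.
  have -> : map_poly phi (map_poly polyC (W l)) = map_poly polyC (phi (W l)).
    by rewrite -!map_poly_comp; apply: eq_map_poly => z /=; rewrite /phi map_polyC.
  have -> : (map_poly polyC (phi (W l))).[(rho i)%:P] = (evalz (rho i) (W l))%:P.
    by rewrite horner_map.
  have gWc : (evalz (rho i) g)%:P * (evalz (rho i) (W l))%:P =
      (evalz (rho i) c)%:P * ((rho i) ^+ l)%:P :> {poly C}.
    have := gW i l (ltnSE (ltn_ord l)); rewrite !rmorphM rmorphXn /= evalzX.
    by rewrite -!polyCM => ->.
  rewrite -[X in _ * (X * _)]/(map_poly (intr : int -> C) (b l)).
  have -> : map_poly intr (b l) = ((-1) ^+ l * 'C(L, l)%:R) *: 'X^(L - l) :> {poly C}.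
    by rewrite /b map_polyZ map_polyXn rmorphM rmorphXn rmorphN1 /= rmorph_nat.
  rewrite mulrCA gWc -mul_polyC polyCM !rmorphXn /= polyCN polyC_natr -mulr_natr polyC1; ring.
pose lc : {poly C} := (a%:~R)%:P.
have {}xE : map_poly (intr : int -> C) x = lc ^+ m * \prod_i (map_poly phi Wt).[(rho i)%:P].
  apply: etrans xE _; congr (_ ^+ _ * _).
  by rewrite coef_map /= /phi map_polyC.
have {}NE : (N%:~R)%:P = lc ^+ D * \prod_i (evalz (rho i) g)%:P :> {poly C}.
  by rewrite NE polyCM rmorphXn /= rmorph_prod.
have {}ME : (M%:~R)%:P = lc ^+ s * \prod_i (evalz (rho i) c)%:P :> {poly C}.
  by rewrite ME polyCM rmorphXn /= rmorph_prod.
have keyprod : (\prod_i (evalz (rho i) g)%:P) * \prod_i (map_poly phi Wt).[(rho i)%:P] =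
    (\prod_i (evalz (rho i) c)%:P) * (\prod_i ('X - (rho i)%:P)) ^+ L.
  by rewrite -prodrXl -!big_split /=; apply: eq_bigr => i _; exact: key.
(* Since a times the product of the T - rho_i is f(T), the factor f^L absorbs L of the D + m powers
   of a. *)
have total : (N * a ^+ s) *: x = (M * a ^+ (D + m - L)) *: f ^+ L.
  apply: (map_inj_poly (f := intr : int -> C) (@intr_inj _)) => //.
  rewrite !map_polyZ [in RHS]rmorphXn /= xE fE -!mul_polyC exprMn.
  rewrite !rmorphM !rmorphXn /= NE ME -/lc.
  have -> : lc ^+ s * \prod_i (evalz (rho i) c)%:P * lc ^+ (D + m - L) *
      (lc ^+ L * (\prod_i ('X - (rho i)%:P)) ^+ L) =
    lc ^+ s * (lc ^+ (D + m - L) * lc ^+ L) *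
      ((\prod_i (evalz (rho i) c)%:P) * (\prod_i ('X - (rho i)%:P)) ^+ L) by ring.
  by rewrite -exprD subnK // exprD -keyprod; ring.
have := congr1 zcontents total; rewrite !zcontentsZ.
have cfX n : zcontents (f ^+ n) = 1.
  elim: n => [|n IH]; first by rewrite expr0 zcontents_monic ?monic1.
  by rewrite exprS zcontentsM IH cf.
by rewrite cfX mulr1 => <-; rewrite -mulrA dvdz_mulr.
Qed.


Variable eta : C.
Hypothesis conj : forall b i, evalz (rho i) b = 0 <-> evalz eta b = 0.

(** Setting X = t^n in U q + V p = c X^j, with p = k q there, makes c t^(n j) a multiple of q; a
    further factor t^(l mod n) reaches every l up to L = 2 (d+1) n - 1. The exponent of a left over
    is then (e + (d+1) n) + (e2 + (d+1) n) - L = e + e2 + 1, free of n and k. *)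
Lemma norm_dvd_fixed (p q : {poly {poly int}}) d e :
  (size p <= d.+2)%N -> (size q <= d.+2)%N ->
  evalz eta (\det (sylv d.+1 d.+1 p q)) != 0 ->
  exists M : int, M != 0 /\ forall n k N, (0 < n)%N ->
    evalz eta p.['X^n] = k%:~R * evalz eta q.['X^n] ->
    N%:~R = a%:~R ^+ (e + d.+1 * n) * \prod_i evalz (rho i) q.['X^n] ->
    (N %| M)%Z.
Proof.
move=> sp sq; set c := \det _ => c0.
have /choice[UV UVP] : forall j, exists UV : {poly {poly int}} * {poly {poly int}},
    (j < d.+1 + d.+1)%N -> [/\ (size UV.1 <= d.+1)%N, (size UV.2 <= d.+1)%N &
      UV.1 * q + UV.2 * p = c%:P * 'X^j].
  move=> j; have [jd|dj] := ltnP j (d.+1 + d.+1); last by exists (0, 0).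
  have [U [V [sU sV UVE]]] := sylv_bezout (Ordinal jd) sp sq.
  by exists (U, V).
pose e2 := \max_(j < d.+1 + d.+1) maxn (csize (UV j).1) (csize (UV j).2).
have [M ME] := conj_norm (leqnSn (size c)).
exists (M * a ^+ (e + e2).+1); split.
  rewrite mulf_neq0 ?expf_neq0 ?conj_lead_neq0 // -(intr_eq0 C) ME.
  rewrite mulf_neq0 ?expf_neq0 ?intr_eq0 ?conj_lead_neq0 //.
  by apply/prodf_neq0 => i _; apply: contraNneq c0 => /conj->.
move=> n k N n0 pkq NE; pose L := (2 * (d.+1 * n)).-1.
have L0 : (0 < 2 * (d.+1 * n))%N by rewrite !muln_gt0 n0.
have -> : (e + e2).+1 = ((e + d.+1 * n) + (e2 + d.+1 * n) - L)%N.
  by rewrite /L; move: (d.+1 * n)%N L0 => x; lia.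
have ln l : (l <= L)%N -> (l %/ n < d.+1 + d.+1)%N.
  rewrite ltn_divLR // addnn -mul2n -mulnA /L.
  by move: (d.+1 * n)%N L0 => x; lia.
pose W l := 'X^(l %% n) * ((UV (l %/ n)%N).1.['X^n] + k%:P * (UV (l %/ n)%N).2.['X^n]).
apply: (@conj_norm_dvd _ _ W _ _ _ _ _ _ _ _ _ NE ME).
- move=> l /ln lL; have [sU sV _] := UVP _ lL.
  have le2 : (maxn (csize (UV (l %/ n)%N).1) (csize (UV (l %/ n)%N).2) <= e2)%N.
    exact: (leq_bigmax (F := fun j : 'I_(d.+1 + d.+1) =>
      maxn (csize (UV j).1) (csize (UV j).2)) (Ordinal lL)).
  move: le2; rewrite geq_max => /andP[cU cV].
  have hU := size_hornerXn (e := e2) n sU (fun l => leq_trans (size_coef_le _ l) (leqW cU)).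
  have hV := size_hornerXn (e := e2) n sV (fun l => leq_trans (size_coef_le _ l) (leqW cV)).
  apply: leq_trans (size_polyMleq _ _) _; rewrite size_polyXn addSn /=.
  apply: (@leq_trans (l %% n + (e2 + d * n).+1)); last first.
    by rewrite mulSn; have := ltn_pmod l n0; lia.
  rewrite leq_add2l (leq_trans (size_polyD _ _)) // geq_max hU.
  by rewrite mul_polyC (leq_trans (size_scale_leq _ _)).
- move=> i l /ln lL; have [_ _ UVE] := UVP _ lL.
  (* p = k q is known at eta only; the relation passes to the conjugates as an integer polynomial
     vanishing at eta. *)
  apply/eqP; rewrite -subr_eq0 -rmorphB; apply/eqP/conj; rewrite rmorphB; apply/eqP; rewrite subr_eq0.
  have := congr1 (fun F : {poly {poly int}} => evalz eta F.['X^n]) UVE.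
  rewrite !hornerE -exprM /W !rmorphM !rmorphD !rmorphM /= pkq evalzC !rmorphXn /= !evalzX => UVeta.
  have -> : eta ^+ l = eta ^+ (n * (l %/ n)) * eta ^+ (l %% n).
    by rewrite -exprD mulnC -divn_eq.
  rewrite mulrA -UVeta.
  by apply/eqP; ring.
- by rewrite /L; move: (d.+1 * n)%N L0 => x; lia.
Qed.

End ConjugateNorm.

(** * Exponential growth of the norms *)

Section Growth.
Variable R : realType.
Local Notation C := R[i].

Lemma expr_unbounded (x B : C) : 1 < x ->
  exists n0, forall n, (n0 <= n)%N -> B \is Num.real -> B < x ^+ n.
Proof.
move=> x1; set y := complex.Re x.
have [xE y1] : x = y%:C%C /\ 1 < y.
  have := x1; rewrite ltcE /= => /andP[/eqP im re]; split=> //.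
  by apply/eqP; rewrite eq_complex /= im !eqxx.
have bern n : 1 + n%:R * (y - 1) <= y ^+ n.
  elim: n => [|n IH]; first by rewrite mul0r addr0.
  rewrite exprS -natr1; have n0 : 0 <= n%:R :> R by [].
  apply: (@le_trans _ _ (y * (1 + n%:R * (y - 1)))); last by rewrite ler_wpM2l //; lra.
  rewrite -subr_ge0.
  have -> : y * (1 + n%:R * (y - 1)) - (1 + (n%:R + 1) * (y - 1)) = n%:R * (y - 1) ^+ 2 by ring.
  by rewrite mulr_ge0 ?sqr_ge0.
pose b := complex.Re B; exists (Num.truncn (`|b| / (y - 1))).+1 => n n0 Breal.
have bn : b < y ^+ n.
  apply: lt_le_trans (bern n); apply: (@le_lt_trans _ _ (n%:R * (y - 1))); last by rewrite ltrDr.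
  apply: le_trans (ler_norm b) _; rewrite -ler_pdivrMr ?subr_gt0 //.
  by apply: le_trans (ltW (truncnS_gt _)) _; rewrite ler_nat.
rewrite xE -rmorphXn ltcE /= bn andbT.
by move: Breal; rewrite realE !lecE /= => /orP[] /andP[/eqP-> _].
Qed.

Lemma horner_bound (h : {poly C}) (z : C) : `|z| <= 1 ->
  `|h.[z]| <= \sum_(i < size h) `|h`_i|.
Proof.
move=> z1; rewrite horner_coef; apply: le_trans (ler_norm_sum _ _ _) _.
apply: ler_sum => i _; rewrite normrM normrX ler_piMr //.
by rewrite exprn_ile1.
Qed.

(** Explicit continuity: h(z) - h(w) = G(z) (z - w) with G bounded on the unit disc. *)
Lemma horner_near_lower (h : {poly C}) (w : C) : h.[w] != 0 ->
  exists delta eps, [/\ 0 < delta, 0 < eps &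
    forall z, `|z| <= 1 -> `|z - w| < eps -> delta <= `|h.[z]|].
Proof.
move=> hw; have /factor_theorem[G GE] : root (h - h.[w]%:P) w.
  by rewrite rootE hornerD hornerN hornerC subrr.
set B := \sum_(i < size G) `|G`_i|.
have B0 : 0 <= B by apply: sumr_ge0 => i _.
have B1 : 0 < B + 1 by rewrite ltr_wpDl.
have hw0 : 0 < `|h.[w]| by rewrite normr_gt0.
exists (`|h.[w]| / 2), (`|h.[w]| / 2 / (B + 1)); split; rewrite ?divr_gt0 //.
move=> z z1 zw; have hzE : h.[w] = h.[z] - G.[z] * (z - w).
  have := congr1 (fun F : {poly C} => F.[z]) GE; rewrite !hornerE => <-.
  by ring.
have : `|h.[w]| <= `|h.[z]| + `|h.[w]| / 2.
  rewrite {1}hzE; apply: le_trans (ler_normB _ _) _; rewrite lerD2l normrM.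
  apply: (@le_trans _ _ ((B + 1) * `|z - w|)).
    by rewrite ler_wpM2r // (le_trans (horner_bound G z1)) // lerDl.
  by rewrite mulrC -ler_pdivlMr // ltW.
by rewrite -lerBlDr [X in X - _](splitr `|h.[w]|) addrK.
Qed.

Lemma expr_small (x eps : C) : `|x| < 1 -> 0 < eps ->
  exists n0, forall n, (n0 <= n)%N -> `|x ^+ n| < eps.
Proof.
move=> x1 e0; have [->|x0] := eqVneq x 0.
  by exists 1%N => -[|n] //= _; rewrite expr0n normr0.
have [|n0 nP] := @expr_unbounded `|x|^-1 eps^-1.
  by rewrite invf_gt1 ?normr_gt0.
exists n0 => n /nP; rewrite normrX exprVn ltf_pV2 ?posrE ?exprn_gt0 ?normr_gt0 //.
by apply; rewrite gtr0_real ?invr_gt0.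
Qed.

(* The dominant term of g(rho^n) is the one of lowest, resp. highest, degree
   according to whether rho is inside or outside the unit circle. *)
Lemma horner_pow_lower (g : {poly C}) v D (rho : C) a0 :
  (forall j, (j < v)%N -> g`_j = 0) -> g`_v != 0 -> size g = D.+1 ->
  g.[rho ^+ a0] != 0 ->
  exists delta eps n0, [/\ 0 < delta, 0 < eps &
    forall n, (n0 <= n)%N -> (`|rho| = 1 -> `|rho ^+ n - rho ^+ a0| < eps) ->
    delta * ((if 1 < `|rho| then `|rho| else 1) ^+ D *
             (if `|rho| < 1 then `|rho| else 1) ^+ v) ^+ n <= `|g.[rho ^+ n]|].
Proof.
move=> gv gv0 sg ga0.
have [lt1|gt1|eq1] := real_ltgtP (normr_real rho) (real1 C).
- pose h := drop_poly v g.
  have gE z : g.[z] = z ^+ v * h.[z].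
    rewrite -[in LHS](poly_take_drop v g) hornerD hornerM hornerXn.
    rewrite (_ : take_poly v g = 0) ?horner0 ?add0r 1?[RHS]mulrC //.
    by apply/polyP => j; rewrite coef_take_poly coef0; case: ifP => // /gv.
  have [|delta [eps [d0 e0 hP]]] := @horner_near_lower h 0.
    by rewrite horner_coef0 coef_drop_poly add0n.
  have [n0 nP] := expr_small lt1 e0.
  exists delta, eps, n0; split=> // n nn0 _.
  rewrite expr1n mul1r gE normrM -exprM mulrC normrX normrX -exprM mulnC.
  rewrite ler_wpM2l ?exprn_ge0 // hP ?subr0 ?nP //.
  by rewrite normrX exprn_ile1 // ltW.
(* The reversed polynomial: g(z) = z^D h(1/z), and 1/rho^n tends to 0. *)
- pose h := \poly_(i < D.+1) g`_(D - i).
  have r0 : rho != 0 by rewrite -normr_gt0 (lt_trans ltr01).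
  have gE z : z != 0 -> g.[z] = z ^+ D * h.[z^-1].
    move=> z0; rewrite horner_poly mulr_sumr (horner_coef_wide (n := D.+1)) ?sg //.
    rewrite [RHS](reindex_inj rev_ord_inj) /=; apply: eq_bigr => i _.
    have iD : (i <= D)%N by rewrite -ltnS.
    have -> : z ^+ D = z ^+ i * z ^+ (D - i) by rewrite -exprD subnKC.
    by rewrite subSS subKn // mulrCA exprVn mulfK // expf_neq0.
  have [|delta [eps [d0 e0 hP]]] := @horner_near_lower h 0.
    have := lead_coef_eq0 g; rewrite lead_coefE sg /= -size_poly_eq0 sg => gD.
    by rewrite horner_coef0 coef_poly subn0 /= gD.
  have rV1 : `|rho^-1| < 1 by rewrite normfV invf_lt1 // (lt_trans ltr01).
  have [n0 nP] := expr_small rV1 e0.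
  exists delta, eps, n0; split=> // n nn0 _.
  rewrite expr1n mulr1 gE ?expf_neq0 // normrM -exprM mulrC normrX normrX -exprM mulnC.
  rewrite ler_wpM2l ?exprn_ge0 // -exprVn hP ?subr0 ?nP //.
  by rewrite normrX exprn_ile1 // ltW.
(* On the circle no term dominates, whence the proviso that rho^n be near rho^a0. *)
- have [delta [eps [d0 e0 hP]]] := horner_near_lower ga0.
  exists delta, eps, 0%N; split=> // n _ /(_ eq1) nP.
  rewrite !expr1n mulr1 expr1n mulr1 hP ?nP //.
  by rewrite normrX eq1 expr1n.
Qed.
End Growth.
Section NormGrowth.
Variable R : realType.
Local Notation C := R[i].
Variables (eta : C) (f : {poly int}) (r : nat) (rho : 'I_r.+1 -> C).
Hypothesis eta1 : `|eta| = 1.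
Hypothesis eta_aperiodic : forall n, (0 < n)%N -> eta ^+ n != 1.
Hypothesis sf : size f = r.+2.
Hypothesis rho_inj : injective rho.
Hypothesis fE : map_poly intr f = (f`_r.+1)%:~R *: \prod_i ('X - (rho i)%:P).
Hypothesis conj : forall b i, evalz (rho i) b = 0 <-> evalz eta b = 0.
Local Notation a := (`|(f`_r.+1)%:~R| : C).
Local Notation big i := (if 1 < `|rho i| then `|rho i| else 1 : C).
Local Notation small i := (if `|rho i| < 1 then `|rho i| else 1 : C).

Lemma conj_neq0 i : rho i != 0.
Proof.
apply/eqP => r0; have /conj : evalz (rho i) 'X = 0 by rewrite evalzX.
by rewrite evalzX => eta0; move: eta1; rewrite eta0 normr0 => /eqP; rewrite eq_sym oner_eq0.
Qed.

Lemma norm_int_ge1 (n : int) : n != 0 -> 1 <= `|n%:~R| :> C.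
Proof. by move=> n0; rewrite -intr_norm ler1z; lia. Qed.

Lemma conj_lead_ge1 : 1 <= a.
Proof. exact/norm_int_ge1/(conj_lead_neq0 sf). Qed.

Lemma big_ge1 i : 1 <= big i.
Proof. by case: ifP => // /ltW. Qed.

Lemma big_mul_small i : big i * small i = `|rho i|.
Proof.
have [lt1|gt1|eq1] := real_ltgtP (normr_real (rho i)) (real1 C).
- by rewrite mul1r.
- by rewrite mulr1.
- by rewrite mulr1.
Qed.

(** All factors are at least 1. If all equal 1, the conjugates lie in the closed disc and |a| = 1,
    which is Kronecker's case. *)
Lemma mahler_gt1 : 1 < a * \prod_i big i.
Proof.
have U1 : 1 <= \prod_i big i.
  by elim/big_ind: _ => // [x y x1 y1|i _]; [exact: mulr_ege1 | exact: big_ge1].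
have [rho1|/existsNP[i /negP nrho1]] := pselect (forall i, `|rho i| <= 1); last first.
  have gt1 : 1 < `|rho i| by rewrite real_ltNge ?normr_real ?real1.
  apply: (@lt_le_trans _ _ (1 * \prod_i big i)); last first.
    by rewrite ler_wpM2r ?conj_lead_ge1 // (le_trans ler01).
  rewrite mul1r (bigD1 i) //= gt1; apply: (lt_le_trans gt1).
  rewrite ler_peMr //; elim/big_ind: _ => // [x y x1 y1|j _]; [exact: mulr_ege1 | exact: big_ge1].
have [lf|lf] := eqVneq `|f`_r.+1| 1; last first.
  apply: (@lt_le_trans _ _ a); last by rewrite ler_peMr.
  rewrite -intr_norm ltr1z; have := conj_lead_neq0 sf; lia.
exfalso; have feta : evalz eta f = 0.
  by apply/(conj f ord0)/rootP; exact: conj_rootf fE _.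
have [i0 rhoi0] : exists i, rho i = eta.
  move: feta; rewrite evalzE fE hornerZ horner_prod => /eqP.
  rewrite mulf_eq0 intr_eq0 (negPf (conj_lead_neq0 sf)) /= => /prodf_eq0[i _].
  by rewrite hornerXsubC subr_eq0 => /eqP etaE; exists i.
have [m m0 /eqP] := kronecker eta1 rho_inj (eq_leq sf) lf conj feta (ex_intro _ i0 rhoi0) rho1.
by rewrite (negPf (eta_aperiodic m0)).
Qed.

(** With U and L the products of the [big i] and [small i], the rate is a^(d-D) (a U)^(D-v) (a U
    L)^v. Here a U is the Mahler measure and a U L = |f_0| is at least 1, so v < D is what makes it
    exceed 1. *)
Lemma leading_rate_gt1 d D v : (v < D)%N -> (D <= d)%N ->
  1 < a ^+ d * \prod_i (big i ^+ D * small i ^+ v).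
Proof.
move=> vD Dd; set U := \prod_i big i; set L := \prod_i small i.
have aUL : 1 <= a * U * L.
  rewrite -mulrA -big_split /=.
  under eq_bigr do rewrite big_mul_small.
  have f0 : `|(f`_0)%:~R : C| = a * \prod_i `|rho i|.
    have := congr1 (fun F : {poly C} => F.[0]) fE.
    rewrite horner_coef0 coef_map hornerZ horner_prod /= => ->.
    rewrite normrM normr_prod; congr (_ * _); apply: eq_bigr => i _.
    by rewrite hornerXsubC sub0r normrN.
  rewrite -f0; apply: norm_int_ge1; rewrite -(intr_eq0 C) -normr_eq0 f0.
  rewrite mulf_neq0 ?normr_eq0 ?intr_eq0 ?(conj_lead_neq0 sf) //.
  by apply/prodf_neq0 => i _; rewrite normr_eq0 conj_neq0.
have aU := mahler_gt1; rewrite -/U in aU.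
rewrite big_split /= !prodrXl -/U -/L.
have -> : a ^+ d * (U ^+ D * L ^+ v) = a ^+ (d - D) * (a * U) ^+ (D - v) * (a * U * L) ^+ v.
  have -> : a ^+ d = a ^+ (d - D) * a ^+ (D - v) * a ^+ v.
    by rewrite -!exprD -addnA (subnK (ltnW vD)) (subnK Dd).
  have -> : U ^+ D = U ^+ (D - v) * U ^+ v by rewrite -exprD (subnK (ltnW vD)).
  by rewrite !exprMn; ring.
have h1 : 1 <= a ^+ (d - D) by rewrite exprn_ege1 // conj_lead_ge1.
have h2 : 1 < (a * U) ^+ (D - v) by rewrite exprn_egt1 // subn_eq0 -ltnNge.
have h3 : 1 <= (a * U * L) ^+ v by rewrite exprn_ege1.
apply: (lt_le_trans h2); rewrite -[X in X <= _]mul1r -[X in X <= _]mulr1.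
by rewrite ler_pM ?ler_wpM2r ?mul1r // ?(le_trans ler01) ?(le_trans ler01 (ltW h2)) // ltW.
Qed.

Lemma norm_AP_not_constant (q : {poly {poly int}}) d D v e (c : int) a0 N :
  (size q <= d.+1)%N -> size (map_poly (evalz eta) q) = D.+1 ->
  (forall j, (j < v)%N -> (map_poly (evalz eta) q)`_j = 0) ->
  (map_poly (evalz eta) q)`_v != 0 -> (v < D)%N -> c != 0 -> (0 < N)%N ->
  ~ forall m, c%:~R = (f`_r.+1)%:~R ^+ (e + d * (a0 + N * m)) *
    \prod_i evalz (rho i) q.['X^(a0 + N * m)].
Proof.
move=> sq sD qv qv0 vD c0 N0 cE.
pose g i := map_poly (evalz (rho i)) q.
have gcoef i j : ((g i)`_j == 0) = ((map_poly (evalz eta) q)`_j == 0).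
  by rewrite !coef_map /=; apply/eqP/eqP => [/(proj1 (conj _ i))|/(proj2 (conj _ i))].
have sg i : size (g i) = D.+1.
  apply/eqP; rewrite eqn_leq; apply/andP; split.
    by apply/leq_sizeP => j Dj; apply/eqP; rewrite gcoef nth_default ?sD.
  rewrite -sD; apply/leq_sizeP => j gj; apply/eqP; rewrite -(gcoef i).
  by rewrite nth_default.
have Dd : (D <= d)%N by rewrite -ltnS -sD (leq_trans (size_poly _ _)).
have gE i n : evalz (rho i) q.['X^n] = (g i).[rho i ^+ n] by exact: evalz_hornerXn.
have ga0 i : (g i).[rho i ^+ a0] != 0.
  have := cE 0%N; rewrite muln0 addn0 => ca0.
  apply: contraNneq c0 => g0; rewrite -(intr_eq0 C) ca0 (bigD1 i) //= gE g0.
  by rewrite mul0r mulr0.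
have /choice[t tP] : forall i, exists t : C * C * nat, [/\ 0 < t.1.1, 0 < t.1.2 &
    forall n, (t.2 <= n)%N -> (`|rho i| = 1 -> `|rho i ^+ n - rho i ^+ a0| < t.1.2) ->
    t.1.1 * (big i ^+ D * small i ^+ v) ^+ n <= `|(g i).[rho i ^+ n]|].
  move=> i; have [||||delta [eps [n0 dP]]] := @horner_pow_lower R (g i) v D (rho i) a0.
  - by move=> j jv; apply/eqP; rewrite gcoef qv.
  - by rewrite gcoef.
  - exact: sg.
  - exact: ga0.
  by exists (delta, eps, n0).
set Lambda := a ^+ d * \prod_i (big i ^+ D * small i ^+ v).
have Lambda1 : 1 < Lambda by exact: leading_rate_gt1.
pose delta := a ^+ e * \prod_i (t i).1.1.
have a_gt0 : 0 < a by apply: lt_le_trans conj_lead_ge1.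
have delta0 : 0 < delta.
  rewrite mulr_gt0 ?exprn_gt0 //; apply: prodr_gt0 => i _.
  by have [] := tP i.
have [n1 n1P] := expr_unbounded (`|c%:~R| / delta) Lambda1.
pose n0 := (\max_i (t i).2 + n1).+1.
pose z i := if `|rho i| == 1 then rho i ^+ (N * n0) else 1.
have z1 i : `|z i| = 1.
  by rewrite /z; case: ifP => [/eqP ri|_]; rewrite ?normrX ?ri ?expr1n ?normr1.
(* 1/S serves as a common lower bound for the finitely many radii. *)
pose S := \sum_i ((t i).1.2)^-1.
have t0 i : 0 < ((t i).1.2)^-1 by rewrite invr_gt0; have [] := tP i.
have St i : ((t i).1.2)^-1 <= S.
  by rewrite /S (bigD1 i) //= lerDl sumr_ge0 // => j _; exact: ltW.
have S0 : 0 < S by apply: lt_le_trans (St ord0).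
have SV0 : 0 < S^-1 by rewrite invr_gt0.
have [m m0 mP] := unit_recurrence z1 SV0.
(* Since m is positive, n passes all thresholds; rho_i^(N n0 m) is close to 1 on the circle, so
   rho_i^n is close to rho_i^a0. *)
pose n := (a0 + N * (n0 * m))%N.
have nn0 : (n0 <= n)%N by rewrite /n mulnCA; move: (N * m)%N (muln_gt0 N m); rewrite N0 m0; nia.
have lower i : (t i).1.1 * (big i ^+ D * small i ^+ v) ^+ n <= `|(g i).[rho i ^+ n]|.
  have [_ _] := tP i; apply.
    apply: leq_trans nn0; apply: leqW; apply: leq_trans (leq_addr _ _).
    exact: (leq_bigmax (F := fun i => (t i).2)).
  move=> ri; have := mP i; rewrite /z ri eqxx -exprM => zi.
  have -> : rho i ^+ n - rho i ^+ a0 = rho i ^+ a0 * (rho i ^+ (N * n0 * m) - 1).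
    by rewrite mulrBr mulr1 -exprD /n mulnA.
  rewrite normrM normrX ri expr1n mul1r; apply: (lt_le_trans zi).
  by rewrite -[leRHS]invrK lef_pV2 ?posrE.
have : delta * Lambda ^+ n <= `|c%:~R|.
  rewrite (cE (n0 * m)%N) -/n normrM normrX normr_prod.
  rewrite /delta /Lambda exprMn -prodrXl mulrACA -big_split /= -exprM -exprD.
  rewrite ler_wpM2l ?exprn_ge0 ?(ltW a_gt0) //; apply: ler_prod => i _.
  rewrite gE lower andbT mulr_ge0 ?exprn_ge0 ?mulr_ge0 ?exprn_ge0 //.
  - by have [/ltW] := tP i.
  - by case: ifP.
  - by case: ifP.
rewrite mulrC -ler_pdivlMr //; apply/negP.
have nn1 : (n1 <= n)%N by apply: leq_trans nn0; rewrite /n0; apply: leqW; rewrite leq_addl.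
have cr : `|c%:~R| / delta \is Num.real.
  by apply: ger0_real; rewrite divr_ge0 // ltW.
by have := n1P n nn1 cr; rewrite real_ltNge // ?ger0_real // exprn_ge0 // ltW // (lt_trans ltr01).
Qed.

End NormGrowth.

(** * Assembling the contradiction *)

(** For n above all degrees in t, the blocks q_j(t) t^(n j) do not overlap: they are digits in base
    t^n. *)
Lemma coef_hornerXn (q : {poly {poly int}}) n i j :
  (forall l, (size (q`_l)%R <= n)%N) -> (i < n)%N ->
  (q.['X^n])`_(i + n * j) = (q`_j)`_i.
Proof.
move=> qn ilt.
have E l : (q`_l * 'X^n ^+ l)`_(i + n * j) = if l == j then (q`_j)`_i else 0.
  rewrite -exprM coefMXn; have [->|lj] := eqVneq l j.
    by rewrite ltnNge leq_addl addnK.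
  case: ltnP => // nl; rewrite nth_default //; apply: leq_trans (qn l) _.
  have lltj : (l < j)%N.
    rewrite ltn_neqAle lj /= leqNgt; apply/negP => jl.
    by move: nl; rewrite leqNgt => /negP; apply; nia.
  nia.
rewrite horner_coef coef_sum; under eq_bigr do rewrite E.
have [jq|qj] := ltnP j (size q).
  by rewrite (bigD1 (Ordinal jq)) //= eqxx big1 ?addr0 // => l /negPf; rewrite -val_eqE /= => ->.
rewrite [q`_j]nth_default // coef0 big1 // => l _; rewrite ltn_eqF //.
exact: leq_trans (ltn_ord l) qj.
Qed.

Lemma le_int_bound (R : realType) (x : R[i]) : exists B : nat,
  forall k : int, `|k%:~R| <= x -> (`|k| <= B)%N.
Proof.
exists (Num.truncn (complex.Re x)).+1 => k.
rewrite -intr_norm -abszE -[(_ : int)%:~R]/(`|k|%N%:R) -(rmorph_nat (real_complex R)).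
rewrite lecE /= => /andP[_ kx]; rewrite -(ler_nat R).
exact: le_trans kx (ltW (truncnS_gt _)).
Qed.

Section IntegralValues.
Variables (R : realType) (eta : R[i]) (P Q : {poly R[i]}).
Variables (S : nat -> Prop) (k : nat -> int).
Hypothesis eta1 : `|eta| = 1.
Hypothesis eta_aperiodic : forall n, (0 < n)%N -> eta ^+ n != 1.
Hypothesis cPQ : coprimep P Q.
Hypothesis PQ_nonconst : forall c, P <> c *: Q.
Hypothesis freqS : forall N, exists2 n, (N <= n)%N & S n.
Hypothesis Sk : forall n, S n -> P.[eta ^+ n] = (k n)%:~R * Q.[eta ^+ n].
Hypothesis SQ : forall n, S n -> Q.[eta ^+ n] != 0.

Lemma aperiodic_inj : injective (fun n => eta ^+ n).
Proof.
have H m n : (m < n)%N -> eta ^+ m != eta ^+ n.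
  move=> mn; apply: contraNneq (eta_aperiodic (n := n - m) _) => [E|]; last by rewrite subn_gt0.
  have m0 : eta ^+ m != 0 by rewrite expf_neq0 // -normr_eq0 eta1 oner_eq0.
  by apply/eqP/(mulIf m0); rewrite -exprD subnK ?(ltnW mn) // mul1r E.
move=> m n /= E; apply/eqP; case: ltngtP => // /H; first by rewrite E eqxx.
by rewrite E eqxx.
Qed.

Lemma value_not_frequent c : ~ (forall N, exists2 n, (N <= n)%N & S n /\ k n = c).
Proof.
move=> freq; pose G := P - c%:~R *: Q.
have [ms [ums sms hms]] := frequently_seq (size G) freq.
have G0 : G != 0.
  by apply/eqP => /eqP; rewrite subr_eq0 => /eqP; exact: PQ_nonconst.
have := max_poly_roots (rs := [seq eta ^+ n | n <- ms]) G0.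
rewrite size_map sms ltnn => H; suff: false by [].
apply: H; last by rewrite map_inj_uniq //; exact: aperiodic_inj.
rewrite all_map; apply/allP => n /hms[Sn kn] /=.
by rewrite rootE hornerD hornerN hornerZ Sk // kn subrr.
Qed.

Lemma aperiodic_algebraic : exists2 b : {poly int}, b != 0 & evalz eta b = 0.
Proof.
apply: contrapT => noalg.
have inj b : evalz eta b = 0 -> b = 0.
  by move=> b0; apply/eqP/negPn/negP => bN0; apply: noalg; exists b.
pose d := (maxn (size P) (size Q)).-1.
have [Q0|Q0] := eqVneq Q 0.
  by have [n _ /SQ] := freqS 0; rewrite Q0 horner0 eqxx.
have mE : maxn (size P) (size Q) = d.+1.
  by rewrite /d prednK // leq_max !size_poly_gt0 Q0 orbT.
have [p [q [c [c0 sp sq pE qE]]]] : exists (p q : {poly {poly int}}) (c : R[i]),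
  [/\ c != 0, (size p <= d.+1)%N, (size q <= d.+1)%N,
      map_poly (evalz eta) p = c *: P & map_poly (evalz eta) q = c *: Q].
  apply: (descent aperiodic_inj cPQ _ _ _ freqS Sk).
  - by rewrite -mE leq_maxl.
  - by rewrite -mE leq_maxr.
  - by rewrite -mE; case: leqP; [right|left].
have q0 : q != 0.
  apply: contra_eqN qE => /eqP->; rewrite map_poly0 eq_sym scale_poly_eq0 negb_or c0.
  exact: Q0.
have [i qi] : exists i, (lead_coef q)`_i != 0.
  by exists (size (lead_coef q)).-1; rewrite -lead_coefE !lead_coef_eq0.
pose n0 := (maxn (csize p) (csize q) + i).+1.
(* One coefficient of p(t, t^n) = k_n q(t, t^n) determines k_n from data independent of n. *)
have ratio n : (n0 <= n)%N -> S n -> (p`_(size q).-1)`_i = k n * (lead_coef q)`_i.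
  move=> n0n Sn.
  have cp l : (size (p`_l)%R <= n)%N.
    apply: leq_trans (size_coef_le p l) _; apply: leq_trans n0n; rewrite /n0; lia.
  have cq l : (size (q`_l)%R <= n)%N.
    apply: leq_trans (size_coef_le q l) _; apply: leq_trans n0n; rewrite /n0; lia.
  have iltn : (i < n)%N by apply: leq_trans n0n; rewrite ltnS leq_addl.
  have pqn : p.['X^n] = k n *: q.['X^n].
    apply/eqP; rewrite -subr_eq0; apply/eqP/inj.
    rewrite -mul_polyC rmorphB rmorphM /= evalzC !evalz_hornerXn pE qE !hornerZ Sk //.
    by rewrite mulrCA subrr.
  by rewrite lead_coefE -(coef_hornerXn _ cp iltn) -(coef_hornerXn _ cq iltn) pqn coefZ.
have [n1 n01 Sn1] := freqS n0.
apply: (@value_not_frequent (k n1)) => N; have [n nN Sn] := freqS (maxn N n0).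
move: nN; rewrite geq_max => /andP[Nn n0n]; exists n => //; split=> //.
by apply: (mulIf qi); rewrite -ratio // -ratio.
Qed.

Lemma aperiodic_absurd : False.
Proof.
have [b b0 beta] := aperiodic_algebraic.
have [f [r [rho [cf sf rho_inj fE conj]]]] := ex_conjugates b0 beta.
have [Q0|Q0] := eqVneq Q 0.
  by have [n _ /SQ] := freqS 0; rewrite Q0 horner0 eqxx.
have [d mE] : exists d, maxn (size P) (size Q) = d.+2.
  have : (1 < maxn (size P) (size Q))%N.
    rewrite ltnNge; apply/negP; rewrite geq_max => /andP[/size1_polyC PE /size1_polyC QE].
    have q00 : Q`_0 != 0 by rewrite -polyC_eq0 -QE.
    by apply: (@PQ_nonconst (P`_0 / Q`_0)); rewrite PE QE coefC eqxx -mul_polyC -polyCM coefC eqxx divfK.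
  by case: maxn => [|[|d]] // _; exists d.
have [sP sQ] : (size P <= d.+2)%N /\ (size Q <= d.+2)%N.
  by rewrite -mE leq_maxl leq_maxr.
have sPQ : size P = d.+2 \/ size Q = d.+2.
  by rewrite -mE; case: leqP; [right|left].
have [p [q [c [c0 sp sq pE qE]]]] := descent aperiodic_inj cPQ sP sQ sPQ freqS Sk.
have detpq : evalz eta (\det (sylv d.+1 d.+1 p q)) != 0.
  rewrite -det_map_mx map_sylv pE qE; apply: det_sylv_neq0; rewrite ?size_scale //.
  by rewrite coprimepZl // coprimepZr.
pose e := csize q.
have sqe l : (size (q`_l)%R <= e.+1)%N := leqW (size_coef_le q l).
have [M [M0 MP]] := norm_dvd_fixed cf sf rho_inj fE conj e sp sq detpq.
have /choice[Nm NmE] n : exists N : int,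
    N%:~R = (f`_r.+1)%:~R ^+ (e + d.+1 * n) * \prod_i evalz (rho i) q.['X^n].
  by apply: conj_norm => //; exact: size_hornerXn.
(* n = 0 is excluded because [norm_dvd_fixed] divides exponents by n. *)
pose S' n := (0 < n)%N /\ S n.
have freqS' N : exists2 n, (N <= n)%N & S' n.
  by have [n Nn Sn] := freqS N.+1; exists n; [exact: ltnW | split=> //; apply: leq_trans Nn].
have qeta n : S n -> evalz eta q.['X^n] != 0.
  by move=> Sn; rewrite evalz_hornerXn qE hornerZ mulf_neq0 // SQ.
have [c1 c1P] : exists c1, forall N, exists2 n, (N <= n)%N & S' n /\ Nm n = c1.
  apply: (@frequently_bounded S' Nm `|M|%N) => N; have [n Nn [n0 Sn]] := freqS' N.
  exists n => //; split=> //; apply: dvdn_leq; first by rewrite absz_gt0.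
  rewrite -dvdzE; apply: (MP n (k n)) => //.
  by rewrite !evalz_hornerXn pE qE !hornerZ Sk // mulrCA.
have a0 := conj_lead_neq0 sf.
have c10 : c1 != 0.
  have [n _ [[_ Sn] <-]] := c1P 0; rewrite -(intr_eq0 R[i]) NmE mulf_neq0 ?expf_neq0 ?intr_eq0 //.
  by apply/prodf_neq0 => i _; apply: contra_neq (qeta n Sn) => /conj.
have rho0 i : rho i != 0 by exact: (conj_neq0 eta1 conj).
have [A [B [detB detE]]] := det_exp_sum_norm rho_inj
  (fun i => rootP (conj_rootf fE i)) (eq_leq sf) rho0 a0 sq sqe.
(* The determinant carries a^(e + (d+1) n) once per conjugate, [Nm n] only once in all. The r
   surplus copies give the constant and the geometric factor on the right. *)
have NmdetE n : \det (\sum_j A j * B j ^+ n) =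
    ((f`_r.+1) ^+ (e * r) * Nm n) * ((f`_r.+1) ^+ (d.+1 * r)) ^+ n.
  apply: (@intr_inj R[i]); rewrite detE big_split /= prodr_const card_ord.
  rewrite !rmorphM /= NmE !rmorphXn /= -!exprM.
  have -> : ((e + d.+1 * n) * r.+1 = e * r + d.+1 * r * n + (e + d.+1 * n))%N by ring.
  by rewrite exprD exprD -!mulrA; congr (_ * _); rewrite [LHS]mulrC mulrA.
have freqdet N : exists2 n, (N <= n)%N &
    \det (\sum_j A j * B j ^+ n) = (f`_r.+1 ^+ (e * r) * c1) * (f`_r.+1 ^+ (d.+1 * r)) ^+ n.
  by have [n Nn [_ nc]] := c1P N; exists n => //; rewrite NmdetE nc.
have [n0 [N0 [N0_gt0 APE]]] := det_exp_sum_eq_AP (expf_neq0 _ a0) detB freqdet.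
have APN m : Nm (n0 + N0 * m)%N = c1.
  have := APE m; rewrite NmdetE => /(mulIf (expf_neq0 _ (expf_neq0 _ a0))).
  by move=> /(mulfI (expf_neq0 _ a0)).
have [v Qv Qmin] : exists2 v, Q`_v != 0 & forall j, (j < v)%N -> Q`_j = 0.
  have ex : exists v, Q`_v != 0 by exists (size Q).-1; rewrite -lead_coefE lead_coef_eq0.
  case: (ex_minnP ex) => v Qv vmin; exists v => // j jv; apply/eqP/negPn/negP => /vmin.
  by rewrite leqNgt jv.
have sQE : size Q = (size Q).-1.+1 by rewrite prednK // size_poly_gt0.
have vD : (v <= (size Q).-1)%N.
  by rewrite -ltnS -sQE ltnNge; apply: contraNN Qv => /leq_sizeP ->.
have [vlt|vge] := ltnP v (size Q).-1.
  apply: (@norm_AP_not_constant R eta f r rho eta1 eta_aperiodic sf rho_inj fE conj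
    q d.+1 (size Q).-1 v e c1 n0 N0) => //.
  - by rewrite qE size_scale.
  - by move=> j jv; rewrite qE coefZ Qmin ?mulr0.
  - by rewrite qE coefZ mulf_neq0.
  - by move=> m; rewrite -NmE APN.
have vE : v = (size Q).-1 by apply/eqP; rewrite eqn_leq vD.
(* Q is a monomial, so R is bounded on the unit circle. *)
have QE z : Q.[z] = Q`_v * z ^+ v.
  rewrite horner_coef sQE big_ord_recr /= -vE big1 ?add0r // => j _.
  by rewrite Qmin ?mul0r // vE.
have [B' BP] := le_int_bound ((\sum_(i < size P) `|P`_i|) / `|Q`_v|).
have kB n : S n -> (`|k n| <= B')%N.
  move=> Sn; apply: BP; rewrite ler_pdivlMr ?normr_gt0 //.
  have en : `|eta ^+ n| = 1 by rewrite normrX eta1 expr1n.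
  have <- : `|P.[eta ^+ n]| = `|(k n)%:~R| * `|Q`_v|.
    by rewrite Sk // QE !normrM normrX en expr1n mulr1.
  by apply: horner_bound; rewrite en.
have [|c2 c2P] := @frequently_bounded S k B'.
  by move=> N; have [n Nn Sn] := freqS N; exists n => //; split=> //; exact: kB.
exact: value_not_frequent c2P.
Qed.

End IntegralValues.

Lemma integral_values_periodic (R : realType) (eta : R[i]) (P Q : {poly R[i]})
    (S : nat -> Prop) :
  `|eta| = 1 -> coprimep P Q -> (forall c, P <> c *: Q) ->
  (forall N, exists2 n, (N <= n)%N & S n) ->
  (forall n, S n -> Q.[eta ^+ n] != 0 /\
    exists k : int, P.[eta ^+ n] = k%:~R * Q.[eta ^+ n]) ->
  exists2 n, (0 < n)%N & eta ^+ n = 1.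
Proof.
move=> eta1 cPQ PQ freqS SPQ; apply: contrapT => aper.
have /choice[k kP] n : exists k : int, S n -> P.[eta ^+ n] = k%:~R * Q.[eta ^+ n].
  have [/SPQ[_ [k kE]]|nS] := pselect (S n); first by exists k.
  by exists 0.
apply: (@aperiodic_absurd R eta P Q S k) => //; last by move=> n /SPQ[].
by move=> n n0; apply/eqP => en; apply: aper; exists n.
Qed.

(** * Reduction of the theorem to natural exponents and integer values *)

Lemma infinite_int_frequently (A : set int) : infinite_set A ->
  (forall N, exists2 n : nat, (N <= n)%N & A n%:Z) \/
  (forall N, exists2 n : nat, (N <= n)%N & A (- n%:Z)).
Proof.
move=> infA; apply: contrapT => /not_orP[/existsNP[N1 h1] /existsNP[N2 h2]].
apply: infA; pose s := [seq i%:Z - N2%:Z | i <- iota 0 (N1 + N2)].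
apply: (@sub_finite_set _ _ [set` s]); last exact: finite_seq.
move=> x Ax /=.
have xN1 : x < N1%:Z.
  rewrite ltNge; apply/negP => N1x; apply: h1; exists `|x|%N; first by lia.
  by rewrite gez0_abs //; lia.
have xN2 : - N2%:Z < x.
  rewrite ltNge; apply/negP => N2x; apply: h2; exists `|x|%N; first by lia.
  by rewrite -(_ : x = - `|x|%N%:Z) //; lia.
apply/mapP; exists `|(x + N2%:Z)%R|%N; last by lia.
by rewrite mem_iota; lia.
Qed.

Theorem proposition1p8 (R : realType) (f : {fraction {poly R[i]}}) (eta : R[i])
    (hf : nonconstant f) (heta : `|eta| = 1)
    (hinf : exists gamma : R[i],
       infinite_set [set n : int | exists k : int,
         ratmap f (Some (eta ^ n)) = Some (gamma * k%:~R)]) :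
  exists2 n : nat, (0 < n)%N & n.-unity_root eta.
Proof.
have [gamma infA] := hinf.
set n_ := (frac (generic_quotient.repr f)).1; set d_ := (frac (generic_quotient.repr f)).2.
have d0 : d_ != 0 by exact: denom_ratioP.
set P := ratnum f; set Q := ratden f.
have cPQ : coprimep P Q by apply: coprimep_div_gcd; rewrite d0 orbT.
have PQ c : P <> c *: Q.
  move=> PE; apply: (hf c); rewrite [f]fracE -/n_ -/d_.
  have nE : n_ = P * gcdp n_ d_ by rewrite divpK ?dvdp_gcdl.
  have dE : d_ = Q * gcdp n_ d_ by rewrite divpK ?dvdp_gcdr.
  have -> : n_ = c%:P * d_ by rewrite {1}nE PE -mul_polyC -mulrA -dE.
  by rewrite tofracM mulfK // tofrac_eq0.
have valE z k : ratmap f (Some z) = Some (gamma * k%:~R) ->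
    Q.[z] != 0 /\ P.[z] = k%:~R * (gamma * Q.[z]).
  rewrite /ratmap /proj_point -/P -/Q; case: eqP => // /eqP Qz [PE].
  by split=> //; rewrite mulrCA mulrA -PE divfK.
have main (x : R[i]) (S : nat -> Prop) : `|x| = 1 ->
    (forall N, exists2 n, (N <= n)%N & S n) ->
    (forall n, S n -> exists k : int, ratmap f (Some (x ^+ n)) = Some (gamma * k%:~R)) ->
    exists2 n, (0 < n)%N & x ^+ n = 1.
  move=> x1 freqS SP.
  (* For gamma = 0 the denominator gamma Q would be zero; the values are then the integer 0, and Q
     itself serves. *)
  have [g0|g0] := eqVneq gamma 0.
    apply: (@integral_values_periodic R x P Q S) => // n /SP[k /valE[Qn Pn]].
    by split=> //; exists 0; rewrite Pn g0 !mul0r mulr0.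
  apply: (@integral_values_periodic R x P (gamma *: Q) S) => //.
  - by rewrite coprimepZr.
  - by move=> c; rewrite scalerA; exact: PQ.
  move=> n /SP[k /valE[Qn Pn]]; rewrite hornerZ mulf_neq0 //.
  by split=> //; exists k.
have eta0 : eta != 0 by rewrite -normr_eq0 heta oner_eq0.
have [freq|freq] := infinite_int_frequently infA.
  have [//|n n0 en] := main eta _ heta freq.
  by exists n => //; apply/unity_rootP.
have [||n n0 en] := main eta^-1 _ _ freq.
- by rewrite normfV heta invr1.
- by move=> n [k kE]; exists k; rewrite exprVn exprnN.
by exists n => //; apply/unity_rootP; rewrite -[LHS]invrK -exprVn en invr1.
Qed.
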